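(* Let $\mathcal G$ be a random graph on the vertex set $V$ which satisfies the BK inequality, and suppose that for some $\alpha\in(d/2,d)$ there exists $C>0$ such that $\tau(x,y)\le C\, g_\alpha(x,y)$ for all $x,y\in V$. Let $(\mathcal C_0^i)_{i\ge1}$ be independent copies of the connected component of $0$ in $\mathcal G$. (i) If $\alpha\in\big(\frac{(k+1)d}{2k},\frac{kd}{2(k-1)}\big)$ for some integer $k\ge2$, then there exists $\kappa>0$ such that $$\mathbb E\left[\exp\left(\kappa\cdot|\mathcal C_0^1\cap\dots\cap\mathcal C_0^k|^{\frac{2\alpha}{d}-1}\right)\right]<\infty.$$ (ii) If $\alpha=\frac{kd}{2(k-1)}$ for some integer $k\ge3$, then there exists $\kappa>0$ such that for any $t>e$, $$\mathbb P(|\mathcal C_0^1\cap\dots\cap\mathcal C_0^k|>t)\le\exp\Big(-\kappa\Big(\frac{t}{\log t}\Big)^{\frac{2\alpha}{d}-1}\Big).$$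
   Context: $(V,d_V)$ is a countable metric space, with balls $B(x,r)=\{y\in V: d_V(x,y)\le r\}$, of polynomial volume growth: there are a real $d\ge 1$ and constants $c_1,c_2>0$ with $c_1 r^d\le |B(x,r)|\le c_2 r^d$ for all $x\in V$, $r\ge 1$. A vertex $0\in V$ is fixed arbitrarily. $\mathcal G$ is a random graph with deterministic vertex set $V$ and possibly random edge set; $\{x\longleftrightarrow y\}$ is the event that $x$ and $y$ are connected in $\mathcal G$, and $\tau(x,y)=\mathbb P(x\longleftrightarrow y)$. For $\alpha>0$, $g_\alpha(x,y)=\frac{1}{1+d_V(x,y)^\alpha}$. BK inequality: an event $E$ is increasing if whenever $\{\mathcal G=A\}\subseteq E$ for a fixed graph $A$ with vertex set $V$, then $\{\mathcal G=B\}\subseteq E$ for every graph $B$ on $V$ containing $A$ as a subgraph. A finite graph $A$ witnesses $E$ if $\{A\subseteq\mathcal G\}\subseteq E$. For increasing events $E,F$, $E\circ F$ is the event that there exist two finite subgraphs of $\mathcal G$ with disjoint edge sets, one witnessing $E$ and the other witnessing $F$. $\mathcal G$ satisfies the BK inequality if $\mathbb P(E\circ F)\le \mathbb P(E)\,\mathbb P(F)$ for all increasing events $E,F$.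
   Formalization: In (ii) the bound is proved for every t > e such that t > t0 (some constant t0) or P(|C_0^1 ∩ … ∩ C_0^k| > t) < 1; the literal claim fails at bounded t where this probability equals 1, e.g. for a deterministic finite cluster with more than e points. *)

(* Defs.v *)
From HB Require Import structures.
From mathcomp Require Import all_boot all_order all_algebra finmap.
From mathcomp Require Import all_classical all_reals all_analysis.

Set Implicit Arguments.
Unset Strict Implicit.
Unset Printing Implicit Defensive.

Import Order.TTheory GRing.Theory Num.Theory.

Local Open Scope classical_set_scope.
Local Open Scope ring_scope.
Local Open Scope ereal_scope.

Definition edge (V : choiceType) := {e : {fset V} | #|` e| == 2%N}.

(* All graphs have the same vertex set V, so a graph is determined by its edge
   set; subgraph inclusion is set inclusion and a finite graph is one with
   finitely many edges. *)
Definition graph (V : choiceType) := set (edge V).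

Definition neighbors (V : choiceType) (g : graph V) (x y : V) : Prop :=
  exists2 e : edge V, g e & val e = [fset x; y]%fset.

Definition linked (V : choiceType) (g : graph V) (x y : V) : Prop :=
  exists2 p : seq V, path (fun u v => `[< neighbors g u v >]) x p & last x p = y.

Definition component (V : choiceType) (g : graph V) (x : V) : set V :=
  [set y | linked g x y].

(* The product sigma-algebra on the power set of T, generated by the events
   "t belongs to A". *)
Definition set_events (T : Type) : set (set (set T)) :=
  <<s range (fun (t : T) => [set A : set T | A t]) >>.
Arguments set_events : clear implicits.

Definition random_set (d : measure_display) (Omega : measurableType d)
    (T : Type) (X : Omega -> set T) : Prop :=
  forall S, set_events T S -> measurable (X @^-1` S).

Definition independent_copies (R : realType) (T : Type)
    (d : measure_display) (Omega : measurableType d) (P : probability Omega R)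
    (X : Omega -> set T)
    (d' : measure_display) (Omega' : measurableType d')
    (Q : probability Omega' R) (Y : nat -> Omega' -> set T) : Prop :=
  [/\ forall i, random_set (Y i),
      forall i S, set_events T S -> Q (Y i @^-1` S) = P (X @^-1` S)
    & forall (J : {fset nat}) (S : nat -> set (set T)),
        (forall i, set_events T (S i)) ->
        Q (\bigcap_(i in [set` J]) (Y i @^-1` S i)) =
        \prod_(i <- J) Q (Y i @^-1` S i)].

(* Events of the random graph are represented by sets of graphs, E standing for
   the event that the random graph belongs to E. *)
Definition increasing_event (V : choiceType) (E : set (graph V)) : Prop :=
  forall A B : graph V, A `<=` B -> E A -> E B.

Definition witnesses (V : choiceType) (A : graph V) (E : set (graph V)) : Prop :=
  [set g : graph V | A `<=` g] `<=` E.

Definition disjoint_occurrence (V : choiceType) (E F : set (graph V)) :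
    set (graph V) :=
  [set g | exists A B : graph V,
     [/\ finite_set A /\ finite_set B, A `<=` g /\ B `<=` g, A `&` B = set0,
         witnesses A E & witnesses B F]].

Definition BK_inequality (V : choiceType) (R : realType)
    (d : measure_display) (Omega : measurableType d) (P : probability Omega R)
    (G : Omega -> graph V) : Prop :=
  forall E F : set (graph V),
    set_events (edge V) E -> set_events (edge V) F ->
    increasing_event E -> increasing_event F ->
    P (G @^-1` disjoint_occurrence E F) <= P (G @^-1` E) * P (G @^-1` F).

Definition tau (V : choiceType) (R : realType)
    (d : measure_display) (Omega : measurableType d) (P : probability Omega R)
    (G : Omega -> graph V) (x y : V) : \bar R :=
  P [set w | linked (G w) x y].

(* The library's closed_ball is the closure of the open ball, which can be
   smaller than this set. *)
Definition vball (R : realType) (V : metricType R) (x : V) (r : R) : set V :=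
  [set y | (mdist x y <= r)%R].

Definition polynomial_growth (R : realType) (V : metricType R) (d : R) : Prop :=
  exists c1 c2 : R, [/\ (0 < c1)%R, (0 < c2)%R &
    forall (x : V) (r : R), (1 <= r)%R ->
      (c1 * r `^ d)%:E <= counting (vball x r) <= (c2 * r `^ d)%:E].

Definition g_fun (R : realType) (V : metricType R) (alpha : R) (x y : V) : R :=
  ((1 + mdist x y `^ alpha)^-1)%R.

(* Main.v *)
Require Import Defs.
From mathcomp Require Import all_boot all_order all_algebra finmap.
From mathcomp Require Import all_classical all_reals all_analysis.
From mathcomp Require Import measurable_realfun ring lra.

(** Put beta = 2 alpha - d, let D(x,y) be the distance truncated below at 1,
    and write g = D^(-alpha) for the kernel bounding tau and H = D^(-beta).
    Both parts of the theorem come from a single estimate,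
    [common_cluster_tail]: if k beta > d then, for t >= 1,

      P(|C_1 n ... n C_k| > t) <= B exp(- kappa t^(beta/d)).

    Indeed beta/d = 2 alpha/d - 1, the assumptions of (i) and of (ii) both
    imply k beta > d, and t / log t <= t for t > e.

    One cluster.  If a cluster started at x contains a set S of at least two
    points, it contains a vertex u and edge-disjoint connections from x to u,
    from u to S1 and from u to S2, for some splitting of S into nonempty S1
    and S2 ([branching_point]).  The BK inequality turns this into the
    tree-graph inequality.  Summed over S against a product weight
    psi(S) = prod_(y in S) psi(y), it becomes the quadratic recursion

      W_(n+1)(x) <= sum_y psi(y) tau(x,y) + sum_u tau(x,u) W_n(u)^2

    of [moment_sum_rec].  Since sum_u g(x,u) g(u,y) <= C H(x,y)
    ([convolution_le]) and g(x,u) g(u,y) <= 2^alpha g(x,y) (g(x,u) + g(u,y))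
    ([kernel_split]), the bound W <= 2 C sum_y psi(y) g(.,y) reproduces itself
    as soon as sup_z sum_y psi(y) H(z,y) is small ([moment_sum_le]).  The sum
    of psi(S) over the subsets S of a cluster is prod (1 + psi(y)) over its
    points y, so this is an exponential moment, and Markov's inequality gives
    [cluster_tail]: if sum_y phi(y) H(z,y) <= M for all z in the support of
    phi, then the sum of phi over a cluster exceeds s with probability at most
    B exp(- kappa s / M).

    Several clusters.  Fix r >= 1, let L_j = C_1 n ... n C_j and consider

      F_j(x) = sum of D(x,y)^(-(k-j) beta) over y in L_j with D(x,y) > r.

    The bound F_0 <= a_0 r^(d - k beta) is deterministic, because
    k beta > d.  If F_j <= a_j r^(d - (k-j) beta) at all points, apply
    [cluster_tail] to C_(j+1), independent of L_j, with phi the profile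
    defining F_(j+1)(x) but taken on L_j.  The corresponding M is of order
    r^(d - (k-j) beta): points y at distance at most r from z contribute this
    much because beta < d, the others contribute at most F_j(x) + F_j(z)
    ([far_kernel_step]).  Hence F_(j+1)(x) <= a_(j+1) r^(d - (k-j-1) beta)
    outside an event whose probability is, for each x, at most a constant
    times exp(- theta r^beta), with theta as large as desired.  At the end
    F_k(x) counts the points of L_k at distance more than r from x, so L_k has
    at most a multiple of r^d points.  With r^d proportional to t this is the
    claim, r^beta being proportional to
    t^(beta/d).  The union over x costs only a factor exp(d r^beta) if all
    clusters are cut to the ball of radius exp(r^beta) around the origin, and
    the k clusters meet outside of this ball with probability at most
    sum tau^k, again exponentially small in r^beta. *)

Set Implicit Arguments.
Unset Strict Implicit.
Unset Printing Implicit Defensive.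

Import Order.TTheory GRing.Theory Num.Theory.
Local Open Scope classical_set_scope.
Local Open Scope ring_scope.

(** * Finite sums and powers *)

Lemma ler_of_eq (R : numDomainType) (x y : R) : x = y -> x <= y.
Proof. by move=> ->. Qed.

Lemma ler_sum_fsubset (R : realType) (U : choiceType) (A B : {fset U}) (F : U -> R) :
  (A `<=` B)%fset -> (forall u, 0 <= F u) ->
  \sum_(u <- A) F u <= \sum_(u <- B) F u.
Proof.
move=> /fsubsetP AB F0.
rewrite [leRHS](bigID (mem A)) /= -[leLHS]addr0.
apply: lerD; last by apply: sumr_ge0.
rewrite -[in leRHS]big_filter; apply: ler_of_eq.
apply: perm_big; apply: uniq_perm; rewrite ?filter_uniq ?fset_uniq// => u.
by rewrite mem_filter andb_idr// => /AB.
Qed.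

Lemma sum_injective_points (R : realType) (V : choiceType) (T : finType) (pos : T -> V) :
  injective pos -> exists U : {fset V}, forall (Pr : pred V) (F : V -> R),
  \sum_(i | Pr (pos i)) F (pos i) = \sum_(u <- U | Pr u) F u.
Proof.
move=> inj; exists (seq_fset tt (codom pos)) => Pr F.
rewrite [RHS](perm_big (codom pos)); last first.
  apply: perm_trans (seq_fset_perm _ _) _; rewrite undup_id//.
  exact/injectiveP.
by rewrite /codom /image_mem big_map big_enum_cond; apply: eq_bigl.
Qed.

Lemma dyadic_floor (R : realType) (r : R) : 1 <= r -> exists N, 2 ^+ N <= r < 2 ^+ N.+1.
Proof.
move=> r1.
have ex : exists n, r < 2 ^+ n.
  exists (Num.truncn r).+1; apply: lt_le_trans (truncnS_gt _) _.
  by rewrite -natrX ler_nat ltnW// ltn_expl.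
case: (ex_minnP ex) => -[|n] rn nmin; first by move: rn; rewrite expr0; lra.
exists n; rewrite rn andbT leNgt; apply/negP => /nmin.
by rewrite ltnn.
Qed.

Lemma powR_exprn (R : realType) (x y : R) n : 0 <= x -> (x ^+ n) `^ y = (x `^ y) ^+ n.
Proof.
by move=> x0; rewrite -!powR_mulrn ?powR_ge0// -!powRrM mulrC.
Qed.

Lemma expR_powR (R : realType) (x y : R) : expR x `^ y = expR (x * y).
Proof. by rewrite /powR gt_eqF ?expR_gt0// expRK mulrC. Qed.

(** * Sums of powers of the distance *)

Section KernelSums.
Variables (R : realType) (V : choiceType) (D : V -> V -> R) (d c : R).
Hypothesis D_ge1 : forall x y, 1 <= D x y.
Hypothesis D_sym : forall x y, D x y = D y x.
Hypothesis D_triangle : forall x y z, D x z <= D x y + D y z.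
Hypothesis c_gt0 : 0 < c.
Hypothesis D_growth : forall x r (U : {fset V}), 1 <= r ->
  \sum_(u <- U | D x u <= r) 1 <= c * r `^ d.

Let D_gt0 x y : 0 < D x y. Proof. exact: lt_le_trans (D_ge1 x y). Qed.

Lemma annulus_sum_le a x s (U : {fset V}) : 0 <= a -> 1 <= s ->
  \sum_(u <- U | s < D x u <= 2 * s) D x u `^ (- a)
    <= c * 2 `^ d * s `^ (d - a).
Proof.
move=> a0 s1; have s0 : 0 < s by apply: lt_le_trans s1.
apply: (@le_trans _ _ (\sum_(u <- U | D x u <= 2 * s) s `^ (- a))).
  rewrite [leRHS](bigID (fun u => s < D x u)) /= -[leLHS]addr0.
  apply: lerD; last by apply: sumr_ge0 => u _; exact: powR_ge0.
  under [leLHS]eq_bigl do rewrite andbC.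
  apply: ler_sum => u /andP[_ su]; rewrite !powRN lef_pV2 ?posrE ?powR_gt0//.
  by apply: ge0_ler_powR; rewrite ?nnegrE ?(ltW su)// ltW.
rewrite -[X in \sum_(_ <- _ | _) X]mulr1 -mulr_sumr.
apply: (@le_trans _ _ (s `^ (- a) * (c * (2 * s) `^ d))).
  by apply: ler_wpM2l; [exact: powR_ge0 | apply: D_growth; lra].
rewrite powRM ?(ltW s0)// (_ : d - a = - a + d); last by ring.
rewrite powRD ?(gt_eqF s0) ?implybT//.
by apply: ler_of_eq; ring.
Qed.

(** Cut along the dyadic annuli: for a < d the outermost one dominates. *)
Lemma near_sum_le a : 0 <= a < d -> exists2 C, 0 < C &
  forall x r (U : {fset V}), 1 <= r ->
    \sum_(u <- U | D x u <= r) D x u `^ (- a) <= C * r `^ (d - a).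
Proof.
move=> /andP[a0 ad].
set Q : R := 2 `^ (d - a); set K := c * 2 `^ d.
have K0 : 0 < K by rewrite mulr_gt0// powR_gt0.
have Q1 : 1 < Q.
  by rewrite /Q /powR pnatr_eq0 /= expR_gt1 mulr_gt0 ?subr_gt0 ?ln_gt0 ?ltr1n.
pose C := c + K / (Q - 1).
have C0 : 0 < C by rewrite addr_gt0// divr_gt0// subr_gt0.
have dyadic x (U : {fset V}) N :
    \sum_(u <- U | D x u <= 2 ^+ N) D x u `^ (- a) <= C * Q ^+ N.
  elim: N => [|N IH].
    rewrite !expr0 mulr1.
    apply: (@le_trans _ _ (\sum_(u <- U | D x u <= 1) 1)).
      apply: ler_sum => u _; rewrite powRN invf_le1 ?powR_gt0//.
      by rewrite -(powRr0 (D x u)) ler_powR.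
    apply: le_trans (D_growth _ _ (lexx 1)) _.
    by rewrite powR1 mulr1 lerDl divr_ge0 ?ltW// subr_gt0.
  rewrite (bigID (fun u => D x u <= 2 ^+ N)) /=.
  have -> : \sum_(u <- U | (D x u <= 2 ^+ N.+1) && (D x u <= 2 ^+ N)) D x u `^ (- a)
      = \sum_(u <- U | D x u <= 2 ^+ N) D x u `^ (- a).
    apply: eq_bigl => u; rewrite andb_idl// => /le_trans; apply.
    by rewrite ler_eXn2l// ltr1n.
  have -> : \sum_(u <- U | (D x u <= 2 ^+ N.+1) && ~~ (D x u <= 2 ^+ N)) D x u `^ (- a)
      = \sum_(u <- U | 2 ^+ N < D x u <= 2 * 2 ^+ N) D x u `^ (- a).
    by apply: eq_bigl => u; rewrite exprS -ltNge andbC.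
  have s1 : (1 : R) <= 2 ^+ N by rewrite exprn_ege1 ?ler1n.
  apply: le_trans (lerD IH (annulus_sum_le x U a0 s1)) _.
  rewrite powR_exprn// -/Q -/K exprS -mulrDl [leRHS]mulrA.
  apply: ler_wpM2r; first by rewrite exprn_ge0// ltW// (lt_trans _ Q1).
  have -> : C * Q = C + C * (Q - 1) by ring.
  rewrite lerD2l /C mulrDl divfK ?subr_eq0 ?gt_eqF// lerDr.
  by rewrite mulr_ge0 ?ltW// subr_gt0.
exists (C * Q); first by rewrite mulr_gt0// (lt_trans _ Q1).
move=> x r U r1; have [N /andP[Nr rN]] := dyadic_floor r1.
apply: (@le_trans _ _ (\sum_(u <- U | D x u <= 2 ^+ N.+1) D x u `^ (- a))).
  rewrite [leRHS](bigID (fun u => D x u <= r)) /= -[leLHS]addr0.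
  apply: lerD; last by apply: sumr_ge0 => u _; exact: powR_ge0.
  apply: ler_of_eq.
  apply: eq_bigl => u; rewrite andb_idl// => /le_trans; apply; exact: ltW.
apply: le_trans (dyadic x U N.+1) _.
rewrite exprS mulrA; apply: ler_wpM2l.
  by rewrite mulr_ge0 ?ltW// (lt_trans _ Q1).
rewrite -powR_exprn//; apply: ge0_ler_powR; rewrite ?nnegrE ?exprn_ge0//; lra.
Qed.

(** For a > d the innermost dyadic annulus dominates, so the bound is uniform in
    the finite set U. *)
Lemma far_sum_le a : 0 <= d -> d < a -> exists2 C, 0 < C &
  forall x r (U : {fset V}), 1 <= r ->
    \sum_(u <- U | r < D x u) D x u `^ (- a) <= C * r `^ (d - a).
Proof.
move=> d0 da; have a0 : 0 <= a by lra.
set Q : R := 2 `^ (d - a); set K := c * 2 `^ d.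
have K0 : 0 < K by rewrite mulr_gt0// powR_gt0.
have Q0 : 0 < Q by rewrite powR_gt0.
have Q1 : Q < 1.
  by rewrite /Q /powR pnatr_eq0 /= expR_lt1 pmulr_llt0 ?subr_lt0// ln_gt0 ?ltr1n.
exists (K / (1 - Q)); first by rewrite divr_gt0// subr_gt0.
move=> x r U r1.
have r0 : 0 < r by lra.
have dyadic N : \sum_(u <- U | r < D x u <= r * 2 ^+ N) D x u `^ (- a)
    <= K / (1 - Q) * r `^ (d - a) * (1 - Q ^+ N).
  elim: N => [|N IH].
    rewrite !expr0 mulr1 subrr mulr0 big_pred0// => u.
    by apply/negbTE/negP => /andP[/lt_le_trans h /h]; rewrite ltxx.
  have s1 : 1 <= r * 2 ^+ N by rewrite mulr_ege1 ?exprn_ege1 ?ler1n.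
  have s_le : r <= r * 2 ^+ N by rewrite ler_peMr ?exprn_ege1 ?ler1n ?(ltW r0).
  rewrite (bigID (fun u => D x u <= r * 2 ^+ N)) /=.
  have -> : \sum_(u <- U | (r < D x u <= r * 2 ^+ N.+1) && (D x u <= r * 2 ^+ N))
      D x u `^ (- a) = \sum_(u <- U | r < D x u <= r * 2 ^+ N) D x u `^ (- a).
    apply: eq_bigl => u; case: (r < _) => //=.
    rewrite andb_idl// => /le_trans; apply.
    by rewrite ler_pM2l// ler_eXn2l// ltr1n.
  have -> : \sum_(u <- U | (r < D x u <= r * 2 ^+ N.+1) && ~~ (D x u <= r * 2 ^+ N))
      D x u `^ (- a) =
      \sum_(u <- U | r * 2 ^+ N < D x u <= 2 * (r * 2 ^+ N)) D x u `^ (- a).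
    apply: eq_bigl => u; rewrite exprS mulrCA -ltNge.
    case: (ltP (r * 2 ^+ N) (D x u)) => [h|_]; last by rewrite andbF.
    by rewrite (le_lt_trans s_le h) andbT.
  apply: le_trans (lerD IH (annulus_sum_le x U a0 s1)) _.
  rewrite powRM ?(ltW r0) ?exprn_ge0// powR_exprn// -/Q -/K.
  apply: ler_of_eq.
  rewrite exprS; field; rewrite subr_eq0 eq_sym; lra.
have [N HN] : exists N, forall u, u \in U -> D x u <= r * 2 ^+ N.
  pose m := \sum_(u <- U) D x u.
  exists (Num.truncn m).+1 => u uU.
  have um : D x u <= m.
    rewrite /m (big_rem u)//= lerDl sumr_ge0// => v _; exact: ltW.
  apply: (le_trans um); apply: le_trans (ltW (truncnS_gt m)) _.
  apply: (@le_trans _ _ (2 ^+ (Num.truncn m).+1)).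
    by rewrite -natrX ler_nat ltnW// ltn_expl.
  by rewrite ler_peMl// exprn_ge0.
rewrite big_seq_cond.
apply: (@le_trans _ _ (\sum_(u <- U | r < D x u <= r * 2 ^+ N) D x u `^ (- a))).
  rewrite [leRHS]big_seq_cond; apply: ler_of_eq.
  by apply: eq_bigl => u; case: (boolP (u \in U)) => //= /HN ->; rewrite andbT.
apply: le_trans (dyadic N) _.
have K1 : 0 <= K / (1 - Q) by rewrite divr_ge0 ?subr_ge0 ?(ltW K0) ?(ltW Q1).
apply: ler_piMr; first by rewrite mulr_ge0 ?powR_ge0.
by rewrite lerBlDr lerDl exprn_ge0// ltW.
Qed.

(** D(x,y) is at most twice the larger of D(x,u) and D(u,y).  The smaller of the
    two factors is thus at most 2^a D(x,y)^(-a), the larger one at most their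
    sum. *)
Lemma kernel_split a x u y : 0 <= a ->
  D x u `^ (- a) * D u y `^ (- a)
    <= 2 `^ a * D x y `^ (- a) * (D x u `^ (- a) + D u y `^ (- a)).
Proof.
move=> a0.
wlog le_xuy : x y / D x u <= D u y => [wl|].
  case: (leP (D x u) (D u y)) => [/wl//|/ltW le_uxy].
  rewrite mulrC [D x u `^ (- a) + _]addrC (D_sym x u) (D_sym u y) (D_sym x y).
  by apply: wl; rewrite (D_sym y u) (D_sym u x).
have Dxy : D x y `^ a <= 2 `^ a * D u y `^ a.
  rewrite -powRM ?(ltW (D_gt0 _ _))//.
  apply: ge0_ler_powR; rewrite ?nnegrE ?mulr_ge0 ?(ltW (D_gt0 _ _))//.
  by have := D_triangle x u y; lra.
have guy : D u y `^ (- a) <= 2 `^ a * D x y `^ (- a).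
  by rewrite !powRN ler_pdivlMr ?powR_gt0// mulrC ler_pdivrMr ?powR_gt0.
rewrite mulrC [leRHS]mulrDr -[leLHS]addr0; apply: lerD.
  by apply: ler_wpM2r => //; exact: powR_ge0.
by rewrite !mulr_ge0 ?powR_ge0.
Qed.

(** Among the points u closer to x than to y, those with D(x,u) <= D(x,y) satisfy
    D(u,y)^(-a) <= 2^a D(x,y)^(-a), which leaves a near sum; for the others the
    product is at most D(x,u)^(-2a), a far sum because 2 a > d. *)
Lemma convolution_le a : 0 <= a < d -> d < 2 * a -> exists2 C, 0 < C &
  forall x y (U : {fset V}),
    \sum_(u <- U) D x u `^ (- a) * D u y `^ (- a) <= C * D x y `^ (d - 2 * a).
Proof.
move=> /andP[a0 ad] da.
have [C1 C10 near] := near_sum_le (introT andP (conj a0 ad)).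
have d0 : 0 <= d by lra.
have [C2 C20 far] := far_sum_le d0 da.
pose C := 2 `^ a * C1 + C2.
have p20 : 0 < 2 `^ a :> R by rewrite powR_gt0.
(* Exchanging x and y reduces to the points u closer to x. *)
have half x y (U : {fset V}) : \sum_(u <- U | D x u <= D u y)
    D x u `^ (- a) * D u y `^ (- a) <= C * D x y `^ (d - 2 * a).
  rewrite (bigID (fun u => D x u <= D x y)) /= mulrDl; apply: lerD.
    apply: (@le_trans _ _ (2 `^ a * D x y `^ (- a) *
        \sum_(u <- U | D x u <= D x y) D x u `^ (- a))).
      rewrite mulr_sumr [leRHS](bigID (fun u => D x u <= D u y)) /= -[leLHS]addr0.
      apply: lerD; last by apply: sumr_ge0 => u _; rewrite !mulr_ge0 ?powR_ge0.
      under [leLHS]eq_bigl do rewrite andbC.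
      apply: ler_sum => u /andP[_ xuy]; rewrite mulrC.
      apply: ler_wpM2r; first exact: powR_ge0.
      rewrite !powRN ler_pdivlMr ?powR_gt0// mulrC ler_pdivrMr ?powR_gt0//.
      rewrite -powRM ?(ltW (D_gt0 _ _))//.
      apply: ge0_ler_powR; rewrite ?nnegrE ?mulr_ge0 ?(ltW (D_gt0 _ _))//.
      by have := D_triangle x u y; lra.
    rewrite -!mulrA ler_pM2l// (_ : d - 2 * a = - a + (d - a)); last by ring.
    rewrite powRD ?(gt_eqF (D_gt0 _ _)) ?implybT// [leRHS]mulrCA.
    by apply: ler_wpM2l; [exact: powR_ge0 | exact: near].
  apply: le_trans (far x _ U (D_ge1 x y)).
  rewrite [leRHS](bigID (fun u => D x u <= D u y)) /= -[leLHS]addr0.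
  apply: lerD; last by apply: sumr_ge0 => u _; exact: powR_ge0.
  under [leLHS]eq_bigl do rewrite -ltNge andbC.
  apply: ler_sum => u /andP[_ xuy].
  rewrite (_ : - (2 * a) = - a - a); last by ring.
  rewrite powRD ?(gt_eqF (D_gt0 _ _)) ?implybT//.
  apply: ler_wpM2l; first exact: powR_ge0.
  rewrite !powRN lef_pV2 ?posrE ?powR_gt0//.
  by apply: ge0_ler_powR; rewrite ?nnegrE ?(ltW (D_gt0 _ _)).
exists (2 * C); first by rewrite mulr_gt0// addr_gt0// mulr_gt0.
move=> x y U; rewrite (bigID (fun u => D x u <= D u y)) /=.
rewrite -mulrA [2 * (_ * _)]mulr_natl mulr2n; apply: lerD; first exact: half.
rewrite (D_sym x y); apply: le_trans (half y x U).
rewrite [leRHS](bigID (fun u => ~~ (D x u <= D u y))) /= -[leLHS]addr0.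
apply: lerD; last by apply: sumr_ge0 => u _; rewrite mulr_ge0 ?powR_ge0.
apply: ler_of_eq; apply: eq_big => [u|u _].
  rewrite andb_idl// -ltNge => /ltW; by rewrite (D_sym y u) (D_sym u x).
by rewrite mulrC (D_sym y u) (D_sym u x).
Qed.

(** Split D(x,u)^(-a) D(u, pos i)^(-a) for one of the two factors of the square;
    what remains is a convolution, at most C eps.  The sum which is squared on
    the left comes back on the right: this is what closes the induction of
    [moment_sum_le]. *)
Lemma quadratic_sum_le a : 0 <= a < d -> d < 2 * a -> exists2 K, 0 < K &
  forall (T : finType) (pos : T -> V) (psi : T -> R) eps,
  (forall i, 0 <= psi i) ->
  (forall z, \sum_i psi i * D z (pos i) `^ (d - 2 * a) <= eps) ->
  forall x (U : {fset V}),
    \sum_(u <- U) D x u `^ (- a) * (\sum_i psi i * D u (pos i) `^ (- a)) ^+ 2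
    <= K * eps * \sum_i psi i * D x (pos i) `^ (- a).
Proof.
move=> ad da; have [C C0 conv] := convolution_le ad da.
exists (2 `^ a * (2 * C)); first by rewrite !mulr_gt0// powR_gt0.
move=> T pos psi eps psi0 psi_eps x U.
pose f u := \sum_i psi i * D u (pos i) `^ (- a).
have f0 u : 0 <= f u by apply: sumr_ge0 => i _; rewrite mulr_ge0 ?powR_ge0.
have conv_f z : \sum_(u <- U) D z u `^ (- a) * f u <= C * eps.
  under eq_bigr do rewrite mulr_sumr.
  rewrite exchange_big /=.
  apply: (@le_trans _ _ (\sum_i psi i * (C * D z (pos i) `^ (d - 2 * a)))).
    apply: ler_sum => i _; under eq_bigr do rewrite mulrCA.
    by rewrite -mulr_sumr; apply: ler_wpM2l.
  under eq_bigr do rewrite mulrCA.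
  by rewrite -mulr_sumr ler_pM2l.
have split_f u : D x u `^ (- a) * f u ^+ 2 <=
    \sum_i 2 `^ a * (psi i * D x (pos i) `^ (- a)) *
      (D x u `^ (- a) * f u + D (pos i) u `^ (- a) * f u).
  have -> : D x u `^ (- a) * f u ^+ 2 =
      \sum_i D x u `^ (- a) * (psi i * D u (pos i) `^ (- a)) * f u.
    by rewrite expr2 mulrA {1}/f mulr_sumr mulr_suml.
  apply: ler_sum => i _.
  have := kernel_split x u (pos i) (proj1 (andP ad)).
  rewrite -(D_sym (pos i) u) => /(ler_wpM2l (psi0 i)) /(ler_wpM2r (f0 u)).
  move=> h; apply: (le_trans (le_trans _ h)); last first.
    by apply: ler_of_eq; ring.
  by apply: ler_of_eq; ring.
apply: le_trans (ler_sum _ (fun u _ => split_f u)) _.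
rewrite exchange_big /= mulr_sumr; apply: ler_sum => i _.
rewrite -mulr_sumr big_split /=.
have := ler_wpM2l (mulr_ge0 (powR_ge0 2 a) (mulr_ge0 (psi0 i) (powR_ge0 (D x (pos i)) (- a))))
  (lerD (conv_f x) (conv_f (pos i))).
by move/le_trans; apply; apply: ler_of_eq; ring.
Qed.

(** A maximum principle: moving z to the nearest point of the support at most
    doubles the distances to the support.  Clusters may branch anywhere in V, but
    a condition at the finitely many points pos j is enough. *)
Lemma kernel_sum_max b (T : finType) (pos : T -> V) (phi : T -> R) M :
  0 <= b -> 0 <= M -> (forall i, 0 <= phi i) ->
  (forall j, \sum_i phi i * D (pos j) (pos i) `^ (- b) <= M) ->
  forall z, \sum_i phi i * D z (pos i) `^ (- b) <= 2 `^ b * M.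
Proof.
move=> b0 M0 phi0 phiM z.
have [i0 _|T0] := pickP [pred i : T | true]; last first.
  by rewrite big1 ?mulr_ge0 ?powR_ge0// => i; have := T0 i.
case: (@Order.TotalTheory.arg_minP _ R T i0 xpredT (fun i => D z (pos i)) isT) => j _ jmin.
apply: (@le_trans _ _ (\sum_i 2 `^ b * (phi i * D (pos j) (pos i) `^ (- b)))).
  apply: ler_sum => i _; rewrite mulrCA; apply: ler_wpM2l => //.
  rewrite !powRN ler_pdivlMr ?powR_gt0// mulrC ler_pdivrMr ?powR_gt0//.
  rewrite -powRM ?(ltW (D_gt0 _ _))//.
  apply: ge0_ler_powR; rewrite ?nnegrE ?mulr_ge0 ?(ltW (D_gt0 _ _))//.
  have := D_triangle (pos j) z (pos i); rewrite (D_sym (pos j) z).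
  by have := jmin i isT; lra.
by rewrite -mulr_sumr; apply: ler_wpM2l => //; exact: powR_ge0.
Qed.
End KernelSums.

(** * Branching of a connected set *)

Section Graphs.
Variable V : choiceType.
Implicit Types (g h : graph V) (x y z u v : V) (F : {fset edge V}).

Lemma neighbors_sym g x y : neighbors g x y -> neighbors g y x.
Proof. by case=> e ge he; exists e => //; rewrite he fsetUC. Qed.

Lemma linked_refl g x : linked g x x.
Proof. by exists [::]. Qed.

Lemma linked_cons g x y z : neighbors g x y -> linked g y z -> linked g x z.
Proof.
by move=> xy [p yp lp]; exists (y :: p) => //=; rewrite yp andbT; apply/asboolP.
Qed.

Lemma linked_trans g x y z : linked g x y -> linked g y z -> linked g x z.
Proof.
move=> [p xp lp] [q yq lq]; exists (p ++ q); last by rewrite last_cat lp.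
by rewrite cat_path xp lp.
Qed.

Lemma linked_edge g x y : neighbors g x y -> linked g x y.
Proof. by move=> xy; apply: (linked_cons xy); exact: linked_refl. Qed.

Lemma linked_ind g y (Pr : V -> Prop) :
  Pr y -> (forall x z, neighbors g x z -> linked g z y -> Pr z -> Pr x) ->
  forall x, linked g x y -> Pr x.
Proof.
move=> Py step x [p]; elim: p x => [x _ /= -> //|z p IH x /= /andP[/asboolP xz zp] lp].
by apply: (step x z) => //; [exists p | exact: IH].
Qed.

Lemma linked_sym g x y : linked g x y -> linked g y x.
Proof.
move: x; apply: linked_ind; first exact: linked_refl.
move=> x z xz _ yz; apply: linked_trans yz _.
exact: linked_edge (neighbors_sym xz).
Qed.

Lemma linked_mono g h x y : g `<=` h -> linked g x y -> linked h x y.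
Proof.
move=> gh; move: x; apply: linked_ind; first exact: linked_refl.
move=> x z [e ge he] _; apply: linked_cons; exists e => //; exact: gh.
Qed.

Lemma linked_finite g x y : linked g x y ->
  exists2 F : {fset edge V}, [set` F] `<=` g & linked [set` F] x y.
Proof.
move: x; apply: linked_ind.
  by exists fset0; [move=> e /= ; rewrite inE | exact: linked_refl].
move=> x z [e ge he] _ [F Fg Fzy]; exists (e |` F)%fset.
  by move=> f /=; rewrite !inE => /orP[/eqP->//|/Fg].
apply: (@linked_cons _ _ z); first by exists e => //=; rewrite !inE eqxx.
by apply: linked_mono Fzy => f /= fF; rewrite !inE fF orbT.
Qed.

Lemma linked_mem_edge g (e : edge V) x y :
  g e -> x \in val e -> y \in val e -> linked g x y.
Proof.
move=> ge xe ye; have [->|xy] := eqVneq x y; first exact: linked_refl.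
apply: linked_edge; exists e => //; apply/esym/eqP.
rewrite eqEfcard; apply/andP; split.
  by apply/fsubsetP => z; rewrite !inE => /orP[] /eqP ->.
by rewrite cardfs2 xy (eqP (valP e)).
Qed.

(** A path from x uses only edges that touch the component of x. *)
Lemma linked_restrict g h x y :
  (forall e z, g e -> z \in val e -> linked g x z -> h e) ->
  linked g x y -> linked h x y.
Proof.
move=> gh [p]; elim: p x gh => [x _ _ /= -> | z p IH x gh /= /andP[/asboolP xz zp] lp].
  exact: linked_refl.
have [e ge he] := xz.
apply: (@linked_cons _ _ z).
  exists e => //; apply: (gh e x) => //; last exact: linked_refl.
  by rewrite he !inE eqxx.
apply: IH => // f w gf wf zw; apply: (gh f w) => //.
exact: linked_cons zw.
Qed.

(** After its last use of e, a path to y continues without e from an end of e. *)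
Lemma linked_remove_edge F (e : edge V) x v y : val e = [fset x; v]%fset ->
  linked [set` F] x y ->
  linked [set` (F `\ e)%fset] x y \/ linked [set` (F `\ e)%fset] v y.
Proof.
move=> he xy.
suff /(_ x xy) [//|//|//] : forall z, linked [set` F] z y ->
    [\/ linked [set` (F `\ e)%fset] z y, linked [set` (F `\ e)%fset] x y
      | linked [set` (F `\ e)%fset] v y].
1, 2, 3: by [left | right].
apply: linked_ind; first by apply: Or31; exact: linked_refl.
move=> z w [f fF hf] _ [wy|xy'|vy]; [|exact: Or32|exact: Or33].
have [fe|fe] := eqVneq f e.
  have : w \in val e by rewrite -fe hf !inE eqxx orbT.
  by rewrite he !inE => /orP[] /eqP wE; [apply: Or32|apply: Or33]; rewrite -wE.
apply: Or31; apply: linked_cons wy; exists f => //=.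
by rewrite !inE fe.
Qed.

Section Split.
Variables (T : finType) (pos : T -> V).
Implicit Types S : {set T}.

Definition reaches x S : set (graph V) :=
  [set g | forall i, i \in S -> linked g x (pos i)].

Lemma reaches_increasing x S : increasing_event (reaches x S).
Proof. by move=> g h gh gS i /gS; exact: linked_mono. Qed.

Lemma reaches_finite x S g : reaches x S g ->
  exists2 F : {fset edge V}, [set` F] `<=` g & reaches x S [set` F].
Proof.
move=> gS.
have /choice[f fP] : forall i, exists F : {fset edge V}, [set` F] `<=` g /\
    (i \in S -> linked [set` F] x (pos i)).
  move=> i; have [iS|iS] := boolP (i \in S).
    by have [F] := linked_finite (gS i iS); exists F.
  by exists fset0; split=> // e /=; rewrite inE.
exists (\bigcup_(i <- enum T) f i)%fset.
  by move=> e /= /bigfcupP[i _ ei]; apply: (fP i).1.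
move=> i iS; apply: linked_mono ((fP i).2 iS) => e /= ei.
by apply/bigfcupP; exists i => //; rewrite mem_enum.
Qed.

(** Induction on the number of edges.  If x is one of the points of S, split it off
    at u = x.  Otherwise remove the first edge e = (x,v) of a path
    leaving x: each point of S is still connected to x or to v.  If all of them
    are connected to v, then v replaces x and e is added to F0; if all of them
    are connected to x, nothing changes.  Otherwise x itself is the branching
    vertex, F1 being the part of the graph in the component of x once e is
    removed, and e belonging to F2. *)
Lemma branching_point F x S : (1 < #|S|)%N -> reaches x S [set` F] ->
  exists u S1 S2 (F0 F1 F2 : {fset edge V}),
  [/\ S1 != finset.set0, S2 != finset.set0, (S1 :&: S2)%SET = finset.set0 & (S1 :|: S2)%SET = S] /\
  [/\ (F0 `|` F1 `|` F2 `<=` F)%fset, [disjoint F0 & F1 `|` F2]%fset,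
      [disjoint F1 & F2]%fset
    & [/\ linked [set` F0] x u, reaches u S1 [set` F1]
        & reaches u S2 [set` F2]]].
Proof.
have [n Fn] := ubnP #|`F|; elim: n F x Fn => // n IH F x Fn cardS FS.
have S0 : S != finset.set0 by rewrite -card_gt0 (leq_trans _ cardS).
have [/existsP[i /andP[iS /eqP xi]]|/existsPn xS] :=
  boolP [exists i, (i \in S) && (pos i == x)].
  exists x, [set i]%SET, (S :\ i)%SET, fset0, fset0, F; split.
    split; last by rewrite finset.setD1K.
    - by rewrite -card_gt0 cards1.
    - by rewrite -card_gt0; move: cardS; rewrite (cardsD1 i) iS.
    - by apply/setP => j; rewrite !inE; case: eqP.
  split; rewrite ?fset0U ?fdisjoint0X//; split.
  - exact: linked_refl.
  - by move=> j; rewrite inE => /eqP ->; rewrite xi; exact: linked_refl.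
  - by move=> j; rewrite !inE => /andP[_]; exact: FS.
have [i iS] := set0Pn _ S0.
have [[|v p] /= xp lp] := FS i iS.
  by move: (xS i); rewrite iS -lp eqxx.
move: xp => /andP[/asboolP [e eF he] _]; set B := (F `\ e)%fset.
have BF : (B `<=` F)%fset by exact: fsubD1set.
have Bn : (#|`B| < n)%N.
  by move: Fn; rewrite (cardfsD1 e F) (_ : e \in F)//= add1n ltnS.
have alt j : j \in S -> linked [set` B] x (pos j) \/ linked [set` B] v (pos j).
  by move=> /FS; exact: linked_remove_edge.
pose S1 := [set j in S | `[< linked [set` B] x (pos j) >]]%SET.
pose S2 := (S :\: S1)%SET.
have S2v j : j \in S2 -> linked [set` B] v (pos j).
  rewrite !inE => /andP[nj jS]; have [xj|//] := alt j jS.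
  by move: nj; rewrite jS /=; case: asboolP.
have [S1_0|S1_0] := eqVneq S1 finset.set0.
  have [|u [T1 [T2 [F0 [F1 [F2 [splitS [FB d0 d1 [vu r1 r2]]]]]]]]] := IH B v Bn cardS.
    by move=> j jS; apply: S2v; rewrite /S2 S1_0 finset.setD0.
  have eB : e \notin B by rewrite !inE eqxx.
  have eF12 : e \notin (F1 `|` F2)%fset.
    apply: contra eB; apply/fsubsetP; apply: fsubset_trans FB.
    by rewrite -fsetUA fsubsetUr.
  exists u, T1, T2, (e |` F0)%fset, F1, F2; split=> //; split => //.
  - rewrite -!fsetUA fsubUset fsetUA (fsubset_trans FB BF) andbT.
    by rewrite fsub1set.
  - by rewrite fdisjointUX fdisjoint1X eF12.
  - split=> //; apply: (@linked_cons _ _ v).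
      by exists e => //=; rewrite !inE eqxx.
    by apply: linked_mono vu => f /= fF; rewrite !inE fF orbT.
have [S2_0|S2_0] := eqVneq S2 finset.set0.
  have [|u [T1 [T2 [F0 [F1 [F2 [splitS [FB d0 d1 r]]]]]]]] := IH B x Bn cardS.
    move=> j jS; apply/asboolP.
    have : j \notin S2 by rewrite S2_0 inE.
    by rewrite !inE jS /= andbT negbK => /asboolP.
  exists u, T1, T2, F0, F1, F2; split=> //; split => //.
  exact: fsubset_trans FB BF.
(* No edge of F2 is reachable from x, otherwise v would be connected to x. *)
pose F1 := [fset f in B | `[< exists2 z, z \in val f & linked [set` B] x z >]]%fset.
pose F2 := (F `\` F1)%fset.
exists x, S1, S2, fset0, F1, F2; split.
  split => //; apply/setP => j; rewrite !inE; case: (j \in S) => //=.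
  - by case: asboolP.
  - by case: asboolP.
have F1B : (F1 `<=` B)%fset by apply/fsubsetP => f; rewrite !inE => /andP[].
split.
- rewrite fset0U fsubUset (fsubset_trans F1B BF) /=; exact: fsubsetDl.
- exact: fdisjoint0X.
- by rewrite fdisjoint_sym; apply/fdisjointP => f; rewrite inE => /andP[].
split; first exact: linked_refl.
  move=> j; rewrite inE => /andP[_ /asboolP xj].
  apply: linked_restrict xj => f z fB zf xz; rewrite /= !inE.
  by move: fB => /=; rewrite !inE => -> /=; apply/asboolP; exists z.
move=> j jS2; have vj := S2v j jS2.
apply: (@linked_cons _ _ v).
  exists e => //=; rewrite !inE eqxx /=; exact: eF.
apply: linked_restrict vj => f z fB zf vz.
have fF : f \in F by exact: (fsubsetP BF).
rewrite /= inE fF andbT; apply/negP; rewrite inE => /andP[_ /asboolP[w wf xw]].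
have xj : linked [set` B] x (pos j).
  apply: linked_trans (S2v j jS2).
  apply: linked_trans (linked_sym vz); apply: linked_trans xw _.
  exact: linked_mem_edge fB wf zf.
move: jS2; rewrite !inE => /andP[/negP + jS]; rewrite jS /=; apply.
exact/asboolP.
Qed.

(** The edge-disjoint finite sets of [branching_point] are witnesses, so the
    connection event is covered by disjoint occurrences, in the nested form to
    which the BK inequality applies twice. *)
Lemma reaches_split x S g : (1 < #|S|)%N -> reaches x S g ->
  exists u S1 S2,
  [/\ S1 != finset.set0, S2 != finset.set0, (S1 :&: S2)%SET = finset.set0 & (S1 :|: S2)%SET = S] /\
  disjoint_occurrence [set h | linked h x u]
    (disjoint_occurrence (reaches u S1) (reaches u S2)) g.
Proof.
move=> cardS /reaches_finite[F Fg FS].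
have [u [S1 [S2 [F0 [F1 [F2 [splitS [FF d0 d1 [xu r1 r2]]]]]]]]] :=
  branching_point cardS FS.
exists u, S1, S2; split=> //.
move: FF; rewrite !fsubUset -andbA => /and3P[/fsubsetP F0F /fsubsetP F1F /fsubsetP F2F].
exists [set` F0], ([set` F1] `|` [set` F2]); split.
- by split; rewrite ?finite_setU; [|split]; exact: finite_fset.
- split; first by move=> f /F0F/Fg.
  by move=> f [/F1F/Fg|/F2F/Fg].
- rewrite -subset0 => f [/= /(fdisjointP d0)]; rewrite inE negb_or.
  by move=> /andP[/negP + /negP] => n1 n2 [].
- by move=> h F0h; exact: linked_mono xu.
move=> h Fh; exists [set` F1], [set` F2]; split.
- by split; exact: finite_fset.
- by split; [move=> f f1|move=> f f2]; apply: Fh; [left|right].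
- by rewrite -subset0 => f [/= /(fdisjointP d1)/negP].
- by move=> k F1k; exact: reaches_increasing r1.
- by move=> k F2k; exact: reaches_increasing r2.
Qed.
End Split.
End Graphs.

(** * Measurability and real-valued probabilities *)

Lemma countable_bigcup_measurable (d : measure_display) (T : measurableType d)
    (U : Type) (D : set U) (F : U -> set T) :
  countable D -> (forall i, D i -> measurable (F i)) ->
  measurable (\bigcup_(i in D) F i).
Proof.
move=> /countable_injP[f finj] Fm.
rewrite (_ : \bigcup_(i in D) F i = \bigcup_n \bigcup_(i in [set i | D i /\ f i = n]) F i).
  apply: bigcupT_measurable => n.
  have [[i [Di fi]]|none] := pselect (exists i, D i /\ f i = n).
    rewrite (_ : \bigcup_(_ in _) _ = F i); first exact: Fm.
    apply/seteqP; split=> [w [j [Dj fj] Fj]|w Fi]; last by exists i.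
    suff <- : j = i by [].
    by apply: finj; rewrite ?inE// fi fj.
  rewrite (_ : \bigcup_(_ in _) _ = set0) ?measurable0//.
  by rewrite -subset0 => w [j Dj _]; apply: none; exists j.
apply/seteqP; split=> [w [i Di Fi]|w [n _ [i [Di _] Fi]]]; last by exists i.
by exists (f i) => //; exists i.
Qed.

Section SetEvents.
Variable T : choiceType.

Let M := g_sigma_algebraType (range (fun t : T => [set A : set T | A t])).

Lemma set_events_mem (t : T) : set_events T [set A | A t].
Proof. by apply: sub_sigma_algebra; exists t. Qed.

Lemma set_eventsC E : set_events T E -> set_events T (~` E).
Proof. exact: (@measurableC _ M). Qed.

Lemma set_eventsI E F : set_events T E -> set_events T F -> set_events T (E `&` F).
Proof. exact: (@measurableI _ M). Qed.

Lemma set_eventsT : set_events T [set: set T].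
Proof. exact: (@measurableT _ M). Qed.

Lemma set_events_countable_bigcup (U : Type) (D : set U) (F : U -> set (set T)) :
  countable D -> (forall i, D i -> set_events T (F i)) ->
  set_events T (\bigcup_(i in D) F i).
Proof. exact: (@countable_bigcup_measurable _ M). Qed.

Lemma set_events_fin_bigcap (I : eqType) (r : seq I) (F : I -> set (set T)) :
  (forall i, i \in r -> set_events T (F i)) ->
  set_events T [set A | forall i, i \in r -> F i A].
Proof.
elim: r => [_|i r IH Fm].
  by rewrite (_ : [set _ | _] = setT); [exact: set_eventsT | apply/seteqP].
rewrite (_ : [set _ | _] = F i `&` [set A | forall i, i \in r -> F i A]).
  apply: set_eventsI; first by apply: Fm; exact: mem_head.
  by apply: IH => j jr; apply: Fm; rewrite inE jr orbT.
apply/seteqP; split=> A /=.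
  move=> FA; split=> [|j jr]; apply: FA; first exact: mem_head.
  by rewrite inE jr orbT.
by move=> [Fi Fr] j; rewrite inE => /orP[/eqP ->|/Fr].
Qed.

(** There are only countably many finite subsets of a countable set. *)
Lemma set_events_supersets (D : set (set T)) : countable [set: T] ->
  D `<=` @finite_set T -> set_events T [set g | exists2 A, D A & A `<=` g].
Proof.
move=> Tc Dfin.
rewrite (_ : [set _ | _] = \bigcup_(A in D) [set g | A `<=` g]); last first.
  by apply/seteqP; split=> g [A DA Ag]; exists A.
apply: set_events_countable_bigcup.
  apply: sub_countable (countable_finite_subset Tc).
  by apply: subset_card_le => A /Dfin.
move=> A /Dfin /finite_fsetP[F ->].
exact: (@set_events_fin_bigcap _ F (fun t => [set g | g t]))
  (fun t _ => set_events_mem t).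
Qed.
End SetEvents.

Section RealProbability.
Variables (R : realType) (disp : measure_display) (Omega : measurableType disp).
Variable P : probability Omega R.
Implicit Types X Y : set Omega.

(** Real-valued probabilities, so that the moment recursion only involves finite
    sums of reals. *)
Definition pr X : R := fine (P X).

Lemma prE X : measurable X -> P X = (pr X)%:E.
Proof. by move=> mX; rewrite fineK// fin_num_measure. Qed.

Lemma pr_ge0 X : 0 <= pr X.
Proof. exact/fine_ge0/measure_ge0. Qed.

Lemma pr_le1 X : measurable X -> pr X <= 1.
Proof. by move=> mX; rewrite -lee_fin -prE// probability_le1. Qed.

Lemma pr_setT : pr setT = 1.
Proof. by rewrite /pr probability_setT. Qed.

Lemma pr_le X Y : measurable X -> measurable Y -> X `<=` Y -> pr X <= pr Y.
Proof.
by move=> mX mY XY; rewrite -lee_fin -!prE// le_measure// inE.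
Qed.

Lemma prU_le X Y : measurable X -> measurable Y -> pr (X `|` Y) <= pr X + pr Y.
Proof.
move=> mX mY; rewrite -lee_fin EFinD -!prE//; last exact: measurableU.
by rewrite measureU2.
Qed.

Lemma pr_union_le (I : eqType) (r : seq I) (Q : pred I) (A : I -> set Omega) X :
  measurable X -> (forall i, i \in r -> Q i -> measurable (A i)) ->
  (forall w, X w -> exists i, [/\ i \in r, Q i & A i w]) ->
  pr X <= \sum_(i <- r | Q i) pr (A i).
Proof.
elim: r X => [|i r IH] X mX mA XA.
  rewrite big_nil (_ : X = set0) /pr ?measure0//.
  by rewrite -subset0 => w /XA[i []].
have mA' j : j \in r -> Q j -> measurable (A j).
  by move=> jr; apply: mA; rewrite inE jr orbT.
rewrite big_cons; case: ifP => Qi; last first.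
  apply: IH => // w /XA[j []]; rewrite inE => /orP[/eqP -> | jr] Qj Aj.
    by rewrite Qj in Qi.
  by exists j.
have mi : measurable (A i) by apply: mA => //; exact: mem_head.
apply: (@le_trans _ _ (pr (A i `|` (X `\` A i)))).
  apply: pr_le => //; first by apply: measurableU => //; exact: measurableD.
  by move=> w Xw; have [|] := pselect (A i w); [left | right].
apply: le_trans (prU_le _ _) _ => //; first exact: measurableD.
rewrite lerD2l; apply: IH => //; first exact: measurableD.
move=> w [/XA[j []]]; rewrite inE => /orP[/eqP -> //|jr Qj Aj _].
by exists j.
Qed.

Lemma pr_total (I : finType) (f : Omega -> I) X :
  (forall i, measurable (f @^-1` [set i])) -> measurable X ->
  pr X = \sum_i pr (X `&` f @^-1` [set i]).
Proof.
move=> mf mX.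
have mA i : measurable (X `&` f @^-1` [set i]) by exact: measurableI.
apply: EFin_inj; rewrite -prE// -sumEFin.
under eq_bigr do rewrite -prE//.
have := @measure_fin_bigcup _ R Omega P I setT (fun i => X `&` f @^-1` [set i]).
rewrite (_ : \bigcup_(_ in _) _ = X); last first.
  by apply/seteqP; split=> [w [i _ []]//|w Xw]; exists (f w).
move=> ->//; first last.
- by apply/trivIsetP => i j _ _ ij; rewrite -subset0 => w [[_ /= fi] [_ /= fj]];
    move: ij; rewrite -fi -fj eqxx.
- exact: finite_finset.
rewrite fsbig_finite; last exact: finite_finset.
rewrite (perm_big (index_enum I))//=.
apply: uniq_perm; rewrite ?fset_uniq ?index_enum_uniq// => i.
rewrite mem_index_enum in_fset_set; first by rewrite in_setT.
exact: finite_finset.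
Qed.

(** Countable subadditivity up to eta, with a finite sum on the right: every sum
    over vertices below is finite. *)
Lemma pr_countable_union_le (U : choiceType) (A : U -> set Omega) X (eta : R) :
  countable [set: U] -> measurable X -> (forall u, measurable (A u)) ->
  X `<=` \bigcup_u A u -> 0 < eta ->
  exists F : {fset U}, pr X <= \sum_(u <- F) pr (A u) + eta.
Proof.
move=> /countable_injP[f finj] mX mA XA eta0; apply: contrapT => none.
pose G n := \bigcup_(u in [set u | f u = n]) A u.
have GE n : (exists2 u, f u = n & G n = A u) \/ G n = set0.
  have [[u fu]|no] := pselect (exists u, f u = n).
    left; exists u => //; apply/seteqP; split=> [w [v /= fv Av]|w Au].
      by rewrite (finj u v) ?inE// fu fv.
    by exists u.
  by right; rewrite -subset0 => w [v fv _]; apply: no; exists v.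
have mG n : measurable (G n).
  by have [[u _ ->]|->] := GE n; [exact: mA | exact: measurable0].
have partial N : exists2 F : {fset U}, (forall u, u \in F -> (f u < N)%N) &
    (\sum_(0 <= n < N) P (G n) = (\sum_(u <- F) pr (A u))%:E)%E.
  elim: N => [|N [F FN IH]]; first by exists fset0; rewrite ?big_nil ?big_geq.
  have [[u fu GA]|G0] := GE N; last first.
    exists F; first by move=> u /FN /ltnW.
    by rewrite big_nat_recr//= IH G0 measure0 adde0.
  exists (u |` F)%fset.
    by move=> v; rewrite !inE => /orP[/eqP ->|/FN/ltnW//]; rewrite fu.
  rewrite big_nat_recr//= IH GA prE// -EFinD big_fsetU1 1?addrC//.
  by apply/negP => /FN; rewrite fu ltnn.
have : (P X <= (pr X - eta)%:E)%E.
  have XG : X `<=` \bigcup_n G n.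
    by move=> w /XA[u _ Au]; exists (f u) => //; exists u.
  apply: le_trans (measure_sigma_subadditive P mG mX XG) _.
  apply: lime_le; first exact: is_cvg_nneseries.
  apply: nearW => N; have [F _ ->] := partial N.
  rewrite lee_fin lerBrDr leNgt; apply/negP => lt; apply: none.
  by exists F; exact: ltW.
by rewrite prE// lee_fin; lra.
Qed.
End RealProbability.

(** * The tree-graph inequality *)

Lemma countable_edge (V : choiceType) : countable [set: V] -> countable [set: edge V].
Proof.
move=> /countable_finite_subset/countable_injP[f finj]; apply/countable_injP.
exists (fun e : edge V => f [set` val e]) => e1 e2 _ _ /finj eq12; apply: val_inj.
have {}eq12 : [set` val e1] = [set` val e2].
  by apply: eq12; rewrite inE; split=> //; exact: finite_fset.
by apply/fsetP => x; have := congr1 (fun A => `[< A x >]) eq12; rewrite /= !asboolb.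
Qed.


Section Events.
Variable V : choiceType.
Hypothesis V_countable : countable [set: V].

(** Increasing events with finite witnesses are measurable: this covers connection
    events and all disjoint occurrences. *)
Lemma set_events_finitary (E : set (graph V)) : increasing_event E ->
  (forall g, E g -> exists2 F : {fset edge V}, [set` F] `<=` g & E [set` F]) ->
  set_events (edge V) E.
Proof.
move=> Einc Efin.
rewrite (_ : E = [set g | exists2 A, (finite_set A /\ E A) & A `<=` g]).
  by apply: set_events_supersets; [exact: countable_edge | move=> A []].
apply/seteqP; split=> [g /Efin[F Fg EF]|g [A [_ EA] Ag]]; last exact: Einc EA.
by exists [set` F] => //; split=> //; exact: finite_fset.
Qed.

Lemma set_events_linked (x y : V) : set_events (edge V) [set g | linked g x y].
Proof.
apply: set_events_finitary => [g h gh|g]; first exact: linked_mono.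
exact: linked_finite.
Qed.

Lemma set_events_reaches (T : finType) (pos : T -> V) x S :
  set_events (edge V) (reaches pos x S).
Proof.
apply: set_events_finitary; first exact: reaches_increasing.
by move=> g; exact: reaches_finite.
Qed.

Lemma disjoint_occurrence_increasing (E F : set (graph V)) :
  increasing_event (disjoint_occurrence E F).
Proof.
move=> g h gh [A [B [fin [Ag Bg] AB0 wA wB]]].
by exists A, B; split=> //; split; [exact: subset_trans gh|exact: subset_trans gh].
Qed.

Lemma set_events_disjoint_occurrence (E F : set (graph V)) :
  set_events (edge V) (disjoint_occurrence E F).
Proof.
apply: set_events_finitary; first exact: disjoint_occurrence_increasing.
move=> g [A [B [[/finite_fsetP[A' ->] /finite_fsetP[B' ->]] [Ag Bg] AB0 wA wB]]].
exists (A' `|` B')%fset.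
  by move=> e /=; rewrite inE => /orP[/Ag|/Bg].
exists [set` A'], [set` B']; split=> //.
- by split; exact: finite_fset.
- by split=> e /= eA; rewrite inE eA ?orbT.
Qed.
End Events.

Section Trace.
Variables (V : Type) (T : finType) (pos : T -> V).

(** What a set reveals of itself at finitely many points; a random variable with
    values in a finite type. *)
Definition trace (A : set V) : {set T} := [set i | `[< A (pos i) >]]%SET.

Lemma in_trace A i : (i \in trace A) = `[< A (pos i) >].
Proof. by rewrite inE. Qed.
End Trace.

Lemma set_events_trace (V : choiceType) (T : finType) (pos : T -> V) (S : {set T}) :
  set_events V [set A | trace pos A = S].
Proof.
rewrite (_ : [set _ | _] = [set A : set V | forall i, i \in index_enum T ->
    (if i \in S then [set B : set V | B (pos i)] else ~` [set B | B (pos i)]) A]).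
  apply: set_events_fin_bigcap => i _; case: ifP => _; last apply: set_eventsC;
  exact: set_events_mem.
apply/seteqP; split=> A /=.
  move=> <- i _; rewrite in_trace; case: ifP => /asboolP //.
move=> AS; apply/setP => i; rewrite in_trace; have := AS i (mem_index_enum i).
by case: ifP => _ /= h; [exact/asboolP | apply/asboolP].
Qed.

Section ClusterMoments.
Variables (R : realType) (V : choiceType).
Hypothesis V_countable : countable [set: V].
Variables (disp : measure_display) (Omega : measurableType disp).
Variables (P : probability Omega R) (G : Omega -> graph V).
Hypothesis G_random : random_set G.
Hypothesis G_BK : BK_inequality P G.

Definition connectivity x y : R := pr P [set w | linked (G w) x y].

Section Reach.
Variables (T : finType) (pos : T -> V).

Definition reach_pr x (S : {set T}) : R := pr P (G @^-1` reaches pos x S).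

Lemma reach_pr_ge0 x S : 0 <= reach_pr x S.
Proof. exact: pr_ge0. Qed.

Lemma reach_pr_set0 x : reach_pr x finset.set0 = 1.
Proof.
rewrite /reach_pr (_ : _ @^-1` _ = setT) ?pr_setT//.
by apply/seteqP; split=> // w _ i; rewrite inE.
Qed.

Lemma reach_pr_set1 x i : reach_pr x [set i]%SET = connectivity x (pos i).
Proof.
congr (pr P _); apply/seteqP; split=> w /= xi; first by apply: xi; rewrite inE.
by move=> j; rewrite inE => /eqP ->.
Qed.

Definition splits (S : {set T}) (q : {set T} * {set T}) :=
  [&& q.1 != finset.set0, q.2 != finset.set0,
      (q.1 :&: q.2)%SET == finset.set0 & (q.1 :|: q.2)%SET == S].

(** BK applied to the two nested disjoint occurrences of [reaches_split], and a
    union bound over the branching vertex and over the splitting of S. *)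
Lemma tree_graph_inequality x (S : {set T}) (eta : R) : (1 < #|S|)%N -> 0 < eta ->
  exists U : {fset V}, reach_pr x S <=
    \sum_(u <- U) \sum_(q | splits S q)
      connectivity x u * (reach_pr u q.1 * reach_pr u q.2) + eta.
Proof.
move=> cardS eta0.
pose occ u (q : {set T} * {set T}) := disjoint_occurrence [set h | linked h x u]
  (disjoint_occurrence (reaches pos u q.1) (reaches pos u q.2)).
pose A u := \bigcup_(q in [set q | splits S q]) G @^-1` occ u q.
have mocc u q : measurable (G @^-1` occ u q).
  by apply: G_random; exact: set_events_disjoint_occurrence.
have mA u : measurable (A u) by apply: countable_bigcup_measurable.
have mS : measurable (G @^-1` reaches pos x S) by apply: G_random; exact: set_events_reaches.
have SA : G @^-1` reaches pos x S `<=` \bigcup_u A u.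
  move=> w /(reaches_split cardS)[u [S1 [S2 [[n1 n2 d12 u12] occS]]]].
  by exists u => //; exists (S1, S2) => //=; rewrite /splits n1 n2 d12 u12 !eqxx.
have [U HU] := pr_countable_union_le P V_countable mS mA SA eta0.
exists U; apply: le_trans HU _; rewrite lerD2r; apply: ler_sum => u _.
apply: le_trans (@pr_union_le _ _ _ P _ (index_enum _) (splits S) (fun q => G @^-1` occ u q) _ _ _ _) _.
- exact: mA.
- by [].
- by move=> w [q Sq Aq]; exists q; rewrite mem_index_enum.
apply: ler_sum => q _.
have BK E F : set_events (edge V) E -> set_events (edge V) F ->
    increasing_event E -> increasing_event F ->
    pr P (G @^-1` disjoint_occurrence E F) <= pr P (G @^-1` E) * pr P (G @^-1` F).
  move=> mE mF iE iF; rewrite -lee_fin EFinM -!prE; try exact: G_random.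
    exact: G_BK.
  by apply: G_random; exact: set_events_disjoint_occurrence.
apply: le_trans (BK _ _ _ _ _ _) _.
- exact: set_events_linked.
- exact: set_events_disjoint_occurrence.
- by move=> g h gh; exact: linked_mono.
- exact: disjoint_occurrence_increasing.
apply: ler_wpM2l; first exact: pr_ge0.
by apply: BK; [exact: set_events_reaches|exact: set_events_reaches
  |exact: reaches_increasing|exact: reaches_increasing].
Qed.

Lemma splits_card S q : splits S q -> (#|S| = #|q.1| + #|q.2|)%N.
Proof.
move=> /and4P[_ _ /eqP d12 /eqP <-].
by rewrite finset.cardsU d12 finset.cards0 subn0.
Qed.

Section Weights.
Variable psi : T -> R.
Hypothesis psi_ge0 : forall i, 0 <= psi i.

Definition weight (S : {set T}) : R := \prod_(i in S) psi i.

Lemma weight_ge0 S : 0 <= weight S.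
Proof. exact: prodr_ge0. Qed.

Lemma weight_splits S q : splits S q -> weight S = weight q.1 * weight q.2.
Proof.
move=> /and4P[_ _ d12 /eqP <-].
have dis : [disjoint q.1 & q.2]%B by rewrite -finset.setI_eq0.
transitivity (\prod_(i in [predU q.1 & q.2]) psi i); last exact: bigU.
by apply: eq_bigl => i; rewrite !inE.
Qed.

(** The bound n on the cardinal of S makes an induction possible, since both
    parts of a splitting are strictly smaller than S. *)
Definition moment_sum n x : R :=
  \sum_(S : {set T} | (0 < #|S| <= n)%N) weight S * reach_pr x S.

Lemma moment_sum_ge0 n x : 0 <= moment_sum n x.
Proof. by apply: sumr_ge0 => S _; rewrite mulr_ge0 ?weight_ge0 ?reach_pr_ge0. Qed.

(** Singletons give the first sum.  For larger S the weight factors over a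
    splitting, and (S1, S2) determines S, so the sum over S and its splittings is
    at most the sum over all pairs, which is a square. *)
Lemma moment_sum_rec n x (eta : R) : 0 < eta -> exists U : {fset V},
  moment_sum n.+1 x <= \sum_i psi i * connectivity x (pos i)
    + \sum_(u <- U) connectivity x u * moment_sum n u ^+ 2 + eta.
Proof.
move=> eta0.
pose big (S : {set T}) := (1 < #|S| <= n.+1)%N.
(* The error eta is shared between the sets S in proportion to their weights. *)
pose Z := \sum_(S | big S) weight S.
have Z0 : 0 <= Z by apply: sumr_ge0 => S _; exact: weight_ge0.
have e0 : 0 < eta / (Z + 1) by rewrite divr_gt0// ltr_wpDl.
have /choice[f fP] : forall S : {set T}, exists U : {fset V}, (1 < #|S|)%N -> reach_pr x S <=
    \sum_(u <- U) \sum_(q | splits S q)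
      connectivity x u * (reach_pr u q.1 * reach_pr u q.2) + eta / (Z + 1).
  move=> S; have [S1|_] := boolP (1 < #|S|)%N; last by exists fset0.
  by have [U HU] := tree_graph_inequality x S1 e0; exists U.
pose U := (\bigcup_(S <- index_enum {set T}) f S)%fset.
exists U; rewrite /moment_sum (bigID (fun S : {set T} => #|S| == 1%N)) /= -addrA.
apply: lerD.
  apply: (@le_trans _ _ (\sum_(S : {set T} | #|S| == 1%N)
      \sum_(i | [set i]%SET == S) weight S * reach_pr x S)).
    rewrite [leRHS](bigID (fun S : {set T} => (0 < #|S| <= n.+1)%N)) /=.
    rewrite -[leLHS]addr0; apply: lerD; last first.
      apply: sumr_ge0 => S _; apply: sumr_ge0 => i _.
      by rewrite mulr_ge0 ?weight_ge0 ?reach_pr_ge0.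
    under [leLHS]eq_bigl do rewrite andbC.
    apply: ler_sum => S /andP[/cards1P[i ->] _].
    rewrite (bigD1 i) //= lerDl; apply: sumr_ge0 => j _.
    by rewrite mulr_ge0 ?weight_ge0 ?reach_pr_ge0.
  rewrite (exchange_big_dep xpredT) //=; apply: ler_sum => i _.
  rewrite (big_pred1 [set i]%SET) => [|S]; last first.
    by rewrite /= (eq_sym S); case: ([set i]%SET =P S) => [<-|_]; rewrite ?cards1 ?andbF.
  by rewrite reach_pr_set1 /weight big_set1.
have bigE (S : {set T}) : ((0 < #|S| <= n.+1)%N && (#|S| != 1%N)) = big S.
  by rewrite /big; case: #|S| => [|[|m]]; rewrite ?andbF ?andbT.
rewrite (eq_bigl _ _ bigE).
have fU S : (f S `<=` U)%fset by apply: bigfcup_sup => //; exact: mem_index_enum.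
pose H u (q : {set T} * {set T}) := connectivity x u *
  ((weight q.1 * reach_pr u q.1) * (weight q.2 * reach_pr u q.2)).
have c0 u : 0 <= connectivity x u by exact: pr_ge0.
have H0 u q : 0 <= H u q by rewrite !mulr_ge0 ?weight_ge0 ?reach_pr_ge0.
apply: (@le_trans _ _ (\sum_(S | big S)
    (\sum_(u <- U) \sum_(q | splits S q) H u q + weight S * (eta / (Z + 1))))).
  apply: ler_sum => S /andP[S1 _].
  apply: le_trans (ler_wpM2l (weight_ge0 S) (fP S S1)) _.
  rewrite mulrDr lerD2r mulr_sumr.
  apply: (@le_trans _ _ (\sum_(u <- f S) \sum_(q | splits S q) H u q)).
    apply: ler_of_eq; apply: eq_bigr => u _.
    rewrite mulr_sumr; apply: eq_bigr => q Sq.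
    by rewrite (weight_splits Sq) /H; ring.
  by apply: ler_sum_fsubset => // u; apply: sumr_ge0.
rewrite big_split /= -mulr_suml -/Z; apply: lerD; last first.
  by rewrite mulrCA ler_piMr ?(ltW eta0)// ler_pdivrMr ?mul1r ?lerDl// ltr_wpDl.
rewrite exchange_big /=; apply: ler_sum => u _.
pose small (S : {set T}) := (0 < #|S| <= n)%N.
rewrite (exchange_big_dep (fun q => small q.1 && small q.2)) /=; last first.
  move=> S q /andP[_ Sn] Sq; move: (Sq) => /and4P[n1 n2 _ _].
  rewrite -!card_gt0 in n1 n2.
  move: Sn; rewrite (splits_card Sq) /small n1 n2 /=.
  case: #|q.1| n1 => // a _; case: #|q.2| n2 => // b _.
  rewrite addSn addnS ltnS => abn.
  by apply/andP; split; apply: leq_trans abn; rewrite ltnS ?leq_addr ?leq_addl.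
apply: (@le_trans _ _ (\sum_(q | small q.1 && small q.2) H u q)).
  apply: ler_sum => q _; rewrite big_mkcond (bigD1 (q.1 :|: q.2)%SET) //= big1.
    by rewrite addr0; case: ifP.
  move=> S Sq; case: ifP => // /andP[_ /and4P[_ _ _ /eqP qS]].
  by rewrite qS eqxx in Sq.
rewrite -mulr_sumr; apply: ler_wpM2l => //.
rewrite expr2 big_distrlr /= pair_big /=.
exact: lexx.
Qed.
End Weights.
End Reach.
End ClusterMoments.

(** * Exponential moments of a cluster *)

Section ClusterTail.
Variables (R : realType) (V : choiceType) (D : V -> V -> R) (d c : R).
Hypothesis D_ge1 : forall x y, 1 <= D x y.
Hypothesis D_refl : forall x, D x x = 1.
Hypothesis D_sym : forall x y, D x y = D y x.
Hypothesis D_triangle : forall x y z, D x z <= D x y + D y z.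
Hypothesis c_gt0 : 0 < c.
Hypothesis D_growth : forall x r (U : {fset V}), 1 <= r ->
  \sum_(u <- U | D x u <= r) 1 <= c * r `^ d.
Hypothesis V_countable : countable [set: V].
Variables (disp : measure_display) (Omega : measurableType disp).
Variables (P : probability Omega R) (G : Omega -> graph V).
Hypothesis G_random : random_set G.
Hypothesis G_BK : BK_inequality P G.
Variables (alpha Ctau : R).
Hypothesis alpha_range : d / 2 < alpha < d.
Hypothesis alpha_ge0 : 0 <= alpha.
Hypothesis Ctau_gt0 : 0 < Ctau.
Hypothesis connectivity_le : forall x y, connectivity P G x y <= Ctau * D x y `^ (- alpha).

Let D_gt0 x y : 0 < D x y. Proof. exact: lt_le_trans (D_ge1 x y). Qed.

(** With eps = 1 / (4 Ctau^2 K), K being the constant of [quadratic_sum_le], the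
    square of the bound contributes to the recursion no more than the first term,
    Ctau times the sum, so that the factor 2 is preserved. *)
Lemma moment_sum_le : exists2 eps, 0 < eps &
  forall (T : finType) (pos : T -> V) (psi : T -> R), (forall i, 0 <= psi i) ->
  (forall z, \sum_i psi i * D z (pos i) `^ (d - 2 * alpha) <= eps) ->
  forall n x, moment_sum P G pos psi n x
    <= 2 * Ctau * \sum_i psi i * D x (pos i) `^ (- alpha).
Proof.
have ad : 0 <= alpha < d by case/andP: alpha_range => _ ->; rewrite alpha_ge0.
have da : d < 2 * alpha by move: alpha_range => /andP[h _]; lra.
have [K K0 quad] := quadratic_sum_le D_ge1 D_sym D_triangle c_gt0 D_growth ad da.
exists (4 * Ctau ^+ 2 * K)^-1; first by rewrite invr_gt0 !mulr_gt0// exprn_gt0.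
move=> T pos psi psi0 psi_eps n.
pose f x := \sum_i psi i * D x (pos i) `^ (- alpha).
have f0 x : 0 <= f x by apply: sumr_ge0 => i _; rewrite mulr_ge0 ?powR_ge0.
elim: n => [x|n IH x].
  rewrite /moment_sum big_pred0; first by rewrite !mulr_ge0 ?f0 ?(ltW Ctau_gt0).
  by move=> S; rewrite leqn0; case: #|S|.
rewrite -/(f x); apply/ler_addgt0Pr => eta eta0.
have [U HU] := moment_sum_rec V_countable G_random G_BK pos psi0 n x eta0.
apply: le_trans HU _; rewrite lerD2r.
rewrite (_ : 2 * Ctau * f x = Ctau * f x + Ctau * f x); last by ring.
apply: lerD.
  rewrite /f mulr_sumr; apply: ler_sum => i _.
  by rewrite mulrCA; apply: ler_wpM2l.
apply: (@le_trans _ _ (\sum_(u <- U)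
    4 * Ctau ^+ 3 * (D x u `^ (- alpha) * f u ^+ 2))).
  apply: ler_sum => u _.
  apply: (@le_trans _ _ (Ctau * D x u `^ (- alpha) * (2 * Ctau * f u) ^+ 2)).
    apply: ler_pM => //; first exact: pr_ge0.
      by rewrite exprn_ge0// moment_sum_ge0.
    have IHu : moment_sum P G pos psi n u <= 2 * Ctau * f u by exact: IH.
    have mu0 := moment_sum_ge0 P G pos psi0 n u.
    by rewrite ler_pXn2r ?nnegrE// (le_trans mu0).
  by apply: ler_of_eq; ring.
rewrite -mulr_sumr.
apply: le_trans (ler_wpM2l _ (quad T pos psi _ psi0 psi_eps x U)) _.
  by rewrite mulr_ge0 ?exprn_ge0 ?ltW.
rewrite -/(f x); apply: ler_of_eq; field.
by rewrite !gt_eqF.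
Qed.

Section Chernoff.
Variables (T : finType) (pos : T -> V) (x : V).

Let tr w := trace pos (component (G w) x).

Lemma measurable_trace_component S : measurable (tr @^-1` [set S]).
Proof.
rewrite (_ : tr @^-1` [set S] = G @^-1` [set g | forall i, i \in index_enum T ->
    (if i \in S then [set h | linked h x (pos i)]
     else ~` [set h | linked h x (pos i)]) g]).
  apply: G_random; apply: set_events_fin_bigcap => i _.
  case: ifP => _; last apply: set_eventsC; exact: set_events_linked.
apply/seteqP; split=> w /=.
  by move=> <- i _; rewrite in_trace; case: ifP => /asboolP.
move=> AS; apply/setP => i; rewrite in_trace; have := AS i (mem_index_enum i).
by case: ifP => _ /= h; [exact/asboolP | apply/asboolP].
Qed.

(** The probabilities of containing S and the law of the trace determine each
    other; going through the trace turns expectations into finite sums. *)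
Lemma reach_pr_trace S :
  reach_pr P G pos x S = \sum_(S' : {set T} | S \subset S') pr P (tr @^-1` [set S']).
Proof.
rewrite /reach_pr (pr_total P measurable_trace_component); last first.
  by apply: G_random; exact: set_events_reaches.
rewrite [RHS]big_mkcond; apply: eq_bigr => S' _.
case: ifP => [/fintype.subsetP SS'|/negP SS'].
  congr (pr P _); apply/seteqP; split=> [w [] //|w /= trS']; split=> // i iS.
  by have := SS' i iS; rewrite -trS' in_trace => /asboolP.
rewrite (_ : _ `&` _ = set0) /pr ?measure0// -subset0 => w [/= xS trS'].
by apply: SS'; apply/fintype.subsetP => i iS; rewrite -trS' in_trace; apply/asboolP/xS.
Qed.

(** The sum over all S of weight(S) P(S is in the cluster) is the expectation of the
    product of 1 + psi over the cluster, and 1 + t >= exp(t/2) on [0,1]; then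
    Markov's inequality. *)
Lemma cluster_chernoff (psi : T -> R) (B s : R) :
  (forall i, 0 <= psi i <= 1) -> moment_sum P G pos psi #|T| x <= B ->
  pr P [set w | s <= \sum_(i in tr w) psi i] <= (1 + B) * expR (- (s / 2)).
Proof.
move=> psi01 momB.
have psi0 i : 0 <= psi i by have /andP[] := psi01 i.
pose mu S := pr P (tr @^-1` [set S]).
have mu0 S : 0 <= mu S by exact: pr_ge0.
have expo : \sum_S mu S * \prod_(i in S) (1 + psi i) <= 1 + B.
  have prodE (S : {set T}) : \prod_(i in S) (1 + psi i) =
      \sum_(S0 : {set T} | S0 \subset S) weight psi S0.
    rewrite big_mkcond /=.
    rewrite (eq_bigr (fun i => (if i \in S then psi i else 0) + 1)); last first.
      by move=> i _; case: ifP => _; rewrite ?add0r// addrC.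
    rewrite bigA_distr /= [RHS]big_mkcond; apply: eq_bigr => S0 _.
    case: ifP => [/fintype.subsetP S0S|/negP S0S].
      rewrite /weight [RHS]big_mkcond; apply: eq_bigr => i _.
      by case: ifP => // /S0S ->.
    have /fintype.subsetPn[i iS0 iS] : ~~ (S0 \subset S) by exact/negP.
    by rewrite (bigD1 i) //= iS0 (negbTE iS) mul0r.
  have -> : \sum_S mu S * \prod_(i in S) (1 + psi i) =
      \sum_(S0 : {set T}) weight psi S0 * reach_pr P G pos x S0.
    under eq_bigr do rewrite prodE mulr_sumr.
    rewrite (exchange_big_dep xpredT) //=; apply: eq_bigr => S0 _.
    by rewrite reach_pr_trace mulr_sumr; apply: eq_bigr => S _; rewrite mulrC.
  rewrite (bigD1 finset.set0) //= /weight big_set0 mul1r reach_pr_set0 lerD2l.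
  apply: le_trans momB; rewrite /moment_sum; apply: ler_of_eq.
  by apply: eq_bigl => S; rewrite card_gt0 max_card andbT.
pose hit (S : {set T}) := s <= \sum_(i in S) psi i.
have -> : pr P [set w | s <= \sum_(i in tr w) psi i] = \sum_(S | hit S) mu S.
  rewrite (pr_total P measurable_trace_component); last first.
    rewrite (_ : [set _ | _] = \bigcup_(S in [set S | hit S]) tr @^-1` [set S]).
      apply: countable_bigcup_measurable => // S _.
      exact: measurable_trace_component.
    by apply/seteqP; split=> [w hw|w [S hS /= trS]]; [exists (tr w) | rewrite trS].
  rewrite [RHS]big_mkcond; apply: eq_bigr => S _; case: ifP => hS.
    by congr (pr P _); apply/seteqP; split=> [w [] //|w /= trS]; split=> //; rewrite /= trS.
  rewrite (_ : _ `&` _ = set0) /pr ?measure0// -subset0 => w [/= + trS].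
  by rewrite trS => h; move: hS; rewrite /hit h.
rewrite expRN ler_pdivlMr ?expR_gt0// mulr_suml.
apply: le_trans expo; rewrite [leRHS](bigID hit) /= -[leLHS]addr0.
apply: lerD; last first.
  apply: sumr_ge0 => S _; rewrite mulr_ge0// prodr_ge0// => i _.
  by rewrite addr_ge0.
apply: ler_sum => S hS; apply: ler_wpM2l => //.
apply: (@le_trans _ _ (\prod_(i in S) expR (psi i / 2))).
  by rewrite -expR_sum ler_expR -mulr_suml ler_pM2r.
apply: ler_prod => i _; rewrite expR_ge0 /=.
(* exp(t/2) <= 1 / (1 - t/2) and (1 + t)(1 - t/2) >= 1 for 0 <= t <= 1. *)
have /andP[p0 p1] := psi01 i.
rewrite -[psi i / 2]opprK expRN invf_ple ?posrE ?expR_gt0//; last by lra.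
apply: le_trans (expR_ge1Dx _).
rewrite -div1r ler_pdivrMr; last by lra.
nra.
Qed.
End Chernoff.

(** Rescale phi so that it becomes an admissible weight: psi = e1 phi / M, where
    e1 / 2 is the exponential rate.  The bound psi <= 1 comes from the diagonal
    terms of the hypothesis, as D(x,x) = 1. *)
Lemma cluster_tail : exists kappa B, [/\ 0 < kappa, 0 < B &
  forall (T : finType) (pos : T -> V) (phi : T -> R) (M s : R) x,
    (forall i, 0 <= phi i) -> 0 < M ->
    (forall j, \sum_i phi i * D (pos j) (pos i) `^ (d - 2 * alpha) <= M) ->
    pr P [set w | s <= \sum_(i in trace pos (component (G w) x)) phi i]
      <= B * expR (- (kappa * (s / M)))].
Proof.
have [eps eps0 mom] := moment_sum_le.
have da : d < 2 * alpha by move: alpha_range => /andP[h _]; lra.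
have ad : alpha < d by move: alpha_range => /andP[].
pose b := 2 * alpha - d.
have bE : d - 2 * alpha = - b by rewrite /b; ring.
have b0 : 0 <= b by rewrite /b; lra.
have p2b : 1 <= 2 `^ b :> R.
  by rewrite -[leLHS](powRr0 2); apply: ler_powR b0; rewrite ler1n.
pose m := Num.min eps 1.
have m0 : 0 < m by rewrite lt_min eps0 ltr01.
(* The factor 2^b is lost in the maximum principle. *)
pose e1 := m / 2 `^ b.
have e10 : 0 < e1 by rewrite divr_gt0// powR_gt0.
have e11 : e1 <= 1.
  by rewrite ler_pdivrMr ?powR_gt0// mul1r (le_trans _ p2b)// ge_min lexx orbT.
exists (e1 / 2), (1 + 2 * Ctau * eps); split.
- by rewrite divr_gt0.
- by rewrite addr_gt0// !mulr_gt0.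
move=> T pos phi M s x phi0 M0 phiM.
pose psi i := e1 / M * phi i.
have eM0 : 0 < e1 / M by rewrite divr_gt0.
have psi0 i : 0 <= psi i by rewrite mulr_ge0// ltW.
have psiM j : \sum_i psi i * D (pos j) (pos i) `^ (- b) <= e1.
  under eq_bigr do rewrite -mulrA.
  rewrite -mulr_sumr -bE.
  apply: le_trans (ler_wpM2l (ltW eM0) (phiM j)) _.
  by rewrite divfK// gt_eqF.
have psi1 i : 0 <= psi i <= 1.
  rewrite psi0 (le_trans _ e11)// (le_trans _ (psiM i))// (bigD1 i)//=.
  by rewrite D_refl powR1 mulr1 lerDl sumr_ge0// => j _; rewrite mulr_ge0 ?powR_ge0.
have psi_eps z : \sum_i psi i * D z (pos i) `^ (d - 2 * alpha) <= eps.
  rewrite bE.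
  apply: le_trans (kernel_sum_max D_ge1 D_sym D_triangle b0 (ltW e10) psi0 psiM z) _.
  rewrite /e1 mulrC divfK ?gt_eqF ?powR_gt0//.
  by rewrite ge_min lexx.
have momB : moment_sum P G pos psi #|T| x <= 2 * Ctau * eps.
  apply: le_trans (mom T pos psi psi0 psi_eps _ x) _.
  rewrite ler_pM2l ?mulr_gt0//; apply: le_trans (psi_eps x).
  apply: ler_sum => i _; apply: ler_wpM2l => //.
  by apply: ler_powR => //; lra.
have := cluster_chernoff (e1 / M * s) psi1 momB.
rewrite (_ : e1 / M * s / 2 = e1 / 2 * (s / M)); last by ring.
apply: le_trans; apply: ler_of_eq.
congr (pr P _); apply/seteqP; split=> w /=; by rewrite /psi -mulr_sumr ler_pM2l.
Qed.
End ClusterTail.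

(** * Intersections of independent copies *)

Section Copies.
Variables (R : realType) (V : choiceType).
Variables (disp : measure_display) (Omega : measurableType disp).
Variables (P : probability Omega R) (X : Omega -> set V).
Variables (disp' : measure_display) (Omega' : measurableType disp').
Variables (Q : probability Omega' R) (C0 : nat -> Omega' -> set V).
Hypothesis C0_copies : independent_copies P X Q C0.

Lemma measurable_copy i E : set_events V E -> measurable (C0 i @^-1` E).
Proof. by case: C0_copies => mC _ _; exact: mC. Qed.

Lemma pr_copy i E : set_events V E -> pr Q (C0 i @^-1` E) = pr P (X @^-1` E).
Proof. by case: C0_copies => _ same _ mE; rewrite /pr same. Qed.

Lemma pr_copies n (E : nat -> set (set V)) : (forall i, set_events V (E i)) ->
  pr Q [set w | forall i, (i < n)%N -> E i (C0 i w)] =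
  \prod_(i < n) pr Q (C0 i @^-1` E i).
Proof.
move=> mE.
have [J JE Jn] : exists2 J : {fset nat}, forall i, (i \in J) = (i < n)%N
    & perm_eq J (iota 0 n).
  exists (seq_fset tt (iota 0 n)); first by move=> i; rewrite seq_fsetE mem_iota.
  by apply: perm_trans (seq_fset_perm _ _) _; rewrite undup_id ?iota_uniq.
case: (C0_copies) => _ _ /(_ J E mE); rewrite (perm_big _ Jn).
rewrite (_ : \bigcap_(i in _) _ = [set w | forall i, (i < n)%N -> E i (C0 i w)]).
  rewrite /pr => ->.
  rewrite (_ : iota 0 n = index_iota 0 n); last by rewrite /index_iota subn0.
  rewrite big_mkord.
  under eq_bigr => i _ do rewrite (prE Q (measurable_copy i (mE i))).
  by rewrite prodEFin.
by apply/seteqP; split=> w h i; have := h i; rewrite /= JE.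
Qed.

Section TraceIntersection.
Variables (T : finType) (pos : T -> V).

Lemma set_events_trace_pred (E : set {set T}) :
  set_events V [set A | E (trace pos A)].
Proof.
rewrite (_ : [set _ | _] = \bigcup_(S in E) [set A | trace pos A = S]).
  by apply: set_events_countable_bigcup => // S _; exact: set_events_trace.
by apply/seteqP; split=> [A EA|A [S ES /= AS]]; [exists (trace pos A) | rewrite AS].
Qed.

Definition common j w : {set T} := trace pos (\bigcap_(i < j) C0 i w).

Lemma common0 w : common 0 w = finset.setT.
Proof. by apply/setP => i; rewrite in_trace inE; apply/asboolP => j; rewrite /= ltn0. Qed.

Lemma commonS j w : common j.+1 w = (common j w :&: trace pos (C0 j w))%SET.
Proof.
apply/setP => x; rewrite !inE; apply/asboolP/andP.
  move=> h; split; apply/asboolP; last exact: (h j (ltnSn j)).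
  by move=> i ij; apply: (h i); exact: ltnW.
move=> [/asboolP h /asboolP hj] i; rewrite /= ltnS leq_eqVlt => /orP[/eqP ->//|].
exact: h.
Qed.

Let traces j w : {ffun 'I_j -> {set T}} := [ffun i : 'I_j => trace pos (C0 i w)].

Let tracesE j (f : {ffun 'I_j -> {set T}}) : traces j @^-1` [set f] =
  [set w | forall i, (i < j)%N -> trace pos (C0 i w) = 
    (if insub i is Some i' then f i' else finset.set0)].
Proof.
apply/seteqP; split=> w /=.
  by move=> wf i ij; rewrite insubT -wf ffunE.
by move=> h; apply/ffunP => i; rewrite ffunE h// valK.
Qed.

Let measurable_traces j f : measurable (traces j @^-1` [set f]).
Proof.
rewrite tracesE.
rewrite (_ : [set _ | _] = \bigcap_(i in [set i | (i < j)%N])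
    (C0 i @^-1` [set A | trace pos A = if insub i is Some i' then f i' else finset.set0])).
  apply: bigcap_measurableType => i _.
  by apply: measurable_copy; exact: set_events_trace.
by apply/seteqP; split=> w h i; apply: h.
Qed.

Let common_traces j w :
  common j w = [set x | [forall i, x \in traces j w i]]%SET.
Proof.
apply/setP => x; rewrite !inE; apply/asboolP/forallP => h i.
  by rewrite ffunE in_trace; apply/asboolP; apply: h => /=; exact: ltn_ord.
move=> /= ij; have := h (Ordinal ij); rewrite ffunE in_trace => /asboolP; exact.
Qed.

Lemma measurable_common j (E : set {set T}) : measurable [set w | E (common j w)].
Proof.
rewrite (_ : [set _ | _] = \bigcup_(f in [set f : {ffun 'I_j -> {set T}} |
    E [set x | [forall i, x \in f i]]%SET]) traces j @^-1` [set f]).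
  by apply: countable_bigcup_measurable.
apply/seteqP; split=> w /=.
  by rewrite common_traces => Ew; exists (traces j w).
by move=> [f Ef /= tf]; rewrite common_traces tf.
Qed.

(** The traces of the first j clusters form a finite-valued vector which determines
    their intersection; decompose according to its value. *)
Lemma pr_common_next j (S : {set T}) (E : set {set T}) :
  pr Q [set w | common j w = S /\ E (trace pos (C0 j w))] =
  pr Q [set w | common j w = S] * pr Q [set w | E (trace pos (C0 j w))].
Proof.
pose K (f : {ffun 'I_j -> {set T}}) : {set T} := [set x | [forall i, x \in f i]]%SET.
have mE : measurable [set w | E (trace pos (C0 j w))].
  exact: (measurable_copy j (set_events_trace_pred E)).
have mL : measurable [set w | common j w = S] := measurable_common j [set S].
rewrite (pr_total Q (@measurable_traces j)); last exact: measurableI.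
rewrite (pr_total Q (@measurable_traces j) mL) mulr_suml.
apply: eq_bigr => f _; have [Kf|Kf] := eqVneq (K f) S; last first.
  rewrite (_ : _ `&` _ = set0); last first.
    rewrite -subset0 => w [[/= wS _] wf]; move: wS; rewrite common_traces.
    by rewrite wf => /eqP; rewrite (negbTE Kf).
  rewrite [X in _ = pr Q X * _](_ : _ `&` _ = set0); last first.
    rewrite -subset0 => w [/= wS wf]; move: wS; rewrite common_traces.
    by rewrite wf => /eqP; rewrite (negbTE Kf).
  by rewrite /pr measure0 mul0r.
rewrite (_ : [set w | common j w = S] `&` _ = traces j @^-1` [set f]); last first.
  by apply/seteqP; split=> [w []//|w /= wf]; split=> //=; rewrite common_traces wf.
rewrite (_ : [set w | _ /\ _] `&` _ =
    traces j @^-1` [set f] `&` [set w | E (trace pos (C0 j w))]); last first.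
  apply/seteqP; split=> [w [[]]//|w [/= wf Ew]]; split=> //; split=> //.
  by rewrite common_traces wf.
pose Ef i := [set A | trace pos A = if insub i is Some i' then f i' else finset.set0].
have mEf i : set_events V (Ef i) by exact: set_events_trace.
pose Eg i := if (i < j)%N then Ef i else [set A | E (trace pos A)].
have mEg i : set_events V (Eg i).
  by rewrite /Eg; case: ifP => _; [exact: mEf | exact: set_events_trace_pred].
rewrite tracesE (pr_copies j mEf).
rewrite (_ : _ `&` _ = [set w | forall i, (i < j.+1)%N -> Eg i (C0 i w)]).
  rewrite (pr_copies _ mEg) big_ord_recr /= {2}/Eg ltnn; congr (_ * _).
  by apply: eq_bigr => i _; rewrite /Eg ltn_ord.
apply/seteqP; split=> w /=.
  move=> [h Ew] i; rewrite ltnS leq_eqVlt => /orP[/eqP ->|ij].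
    by rewrite /Eg ltnn.
  by rewrite /Eg ij; exact: h.
move=> h; split; last by have := h j (ltnSn j); rewrite /Eg ltnn.
by move=> i ij; have := h i (ltnW ij); rewrite /Eg ij.
Qed.

(** The first step at which the good event fails has a good past, and the failure
    then depends only on the next, independent, copy. *)
Lemma pr_common_chain (good : nat -> set {set T}) k (delta : R) :
  good 0%N finset.setT ->
  (forall j S, (j < k)%N -> good j S ->
    pr P [set w | ~ good j.+1 (S :&: trace pos (X w))%SET] <= delta) ->
  pr Q [set w | ~ good k (common k w)] <= k%:R * delta.
Proof.
move=> good0 step.
have m j : measurable [set w | ~ good j (common j w)].
  exact: (measurable_common j [set S | ~ good j S]).
elim: k step => [|k IH] step.
  rewrite mul0r (_ : [set _ | _] = set0) /pr ?measure0//.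
  by rewrite -subset0 => w /=; rewrite common0.
have mb : measurable [set w | good k (common k w) /\ ~ good k.+1 (common k.+1 w)].
  apply: (@measurableI _ _ [set w | good k (common k w)]).
    exact: (measurable_common k [set S | good k S]).
  exact: (m k.+1).
apply: (@le_trans _ _ (pr Q ([set w | ~ good k (common k w)] `|`
    [set w | good k (common k w) /\ ~ good k.+1 (common k.+1 w)]))).
  apply: pr_le => //; first exact: measurableU.
  by move=> w nw; have [g|g] := pselect (good k (common k w)); [right|left].
apply: le_trans (prU_le _ _ _) _ => //.
rewrite -natr1 mulrDl mul1r; apply: lerD.
  by apply: IH => j S jk; apply: step; exact: ltnW.
have mk S : measurable (common k @^-1` [set S]) := measurable_common k [set S].
rewrite (pr_total Q mk mb).
have one : \sum_S pr Q (common k @^-1` [set S]) = 1.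
  rewrite -(pr_setT Q) (pr_total Q mk measurableT).
  by apply: eq_bigr => S _; rewrite setTI.
have d0 : 0 <= delta by apply: le_trans (step 0%N finset.setT _ good0); rewrite ?pr_ge0.
rewrite -[leRHS]mul1r -one mulr_suml; apply: ler_sum => S _.
have [gS|gS] := pselect (good k S); last first.
  rewrite (_ : _ `&` _ = set0) ?/pr ?measure0 ?mulr_ge0 ?pr_ge0//.
  by rewrite -subset0 => w [[/= gw _] wS]; apply: gS; rewrite -wS.
rewrite (_ : _ `&` _ = [set w | common k w = S /\
    ~ good k.+1 (S :&: trace pos (C0 k w))%SET]); last first.
  apply/seteqP; split=> w /=; rewrite commonS.
    by move=> [[_ ng] <-].
  by move=> [wS ng]; rewrite wS.
rewrite (pr_common_next k S (fun S' => ~ good k.+1 (S :&: S')%SET)).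
apply: ler_wpM2l; first exact: pr_ge0.
have mev := set_events_trace_pred (fun S' => ~ good k.+1 (S :&: S')%SET).
by rewrite (pr_copy k mev); exact: step.
Qed.
End TraceIntersection.
End Copies.

(** * Intersections inside a finite set *)

Section FarKernel.
Variables (R : realType) (V : choiceType) (D : V -> V -> R) (d beta r : R).
Hypothesis D_ge1 : forall x y, 1 <= D x y.
Hypothesis beta_ge0 : 0 <= beta.
Hypothesis r_ge1 : 1 <= r.
Variables (T : finType) (pos : T -> V).

Let D_gt0 x y : 0 < D x y. Proof. exact: lt_le_trans (D_ge1 x y). Qed.

(** The contribution to x of the points of L at distance more than r.  The exponent
    m counts the clusters that are still to be intersected with L. *)
Definition far_kernel (m : nat) (L : {set T}) x : R :=
  \sum_(i in L | r < D x (pos i)) D x (pos i) `^ (- (m%:R * beta)).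

(** The summand of [far_kernel], used as a weight on the next cluster. *)
Definition far_profile (m : nat) (L : {set T}) x i : R :=
  if (i \in L) && (r < D x (pos i)) then D x (pos i) `^ (- (m%:R * beta)) else 0.

Lemma far_profile_ge0 m L x i : 0 <= far_profile m L x i.
Proof. by rewrite /far_profile; case: ifP => _; rewrite ?powR_ge0. Qed.

Lemma far_kernelE m L x : far_kernel m L x = \sum_i far_profile m L x i.
Proof. by rewrite /far_kernel big_mkcond. Qed.

(** The far sum after intersecting with one more cluster is an additive functional
    of that cluster, as needed for [cluster_tail]. *)
Lemma far_kernelI m L S x :
  far_kernel m (L :&: S)%SET x = \sum_(i in S) far_profile m L x i.
Proof.
rewrite far_kernelE [RHS]big_mkcond; apply: eq_bigr => i _.
by rewrite /far_profile inE; case: (i \in S); rewrite ?andbT ?andbF.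
Qed.

(** Bound the product of the two powers by the full power at whichever of x and z
    is nearer to pos i. *)
Lemma far_profile_mul m L x z i : r < D z (pos i) ->
  far_profile m L x i * D z (pos i) `^ (- beta)
    <= far_profile m.+1 L x i + far_profile m.+1 L z i.
Proof.
move=> rz; rewrite {1}/far_profile; case: ifP => [/andP[iL rx]|_]; last first.
  by rewrite mul0r addr_ge0 ?far_profile_ge0.
have mE : - (m.+1%:R * beta) = - (m%:R * beta) - beta by rewrite -natr1; ring.
have split y : D y (pos i) `^ (- (m.+1%:R * beta)) =
    D y (pos i) `^ (- (m%:R * beta)) * D y (pos i) `^ (- beta).
  by rewrite mE powRD ?(gt_eqF (D_gt0 _ _)) ?implybT.
have anti b x1 y1 : 0 <= b -> D x1 (pos i) <= D y1 (pos i) ->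
    D y1 (pos i) `^ (- b) <= D x1 (pos i) `^ (- b).
  move=> b0 xy; rewrite !powRN lef_pV2 ?posrE ?powR_gt0//.
  by apply: ge0_ler_powR; rewrite ?nnegrE ?(ltW (D_gt0 _ _)).
have [xz|/ltW zx] := leP (D x (pos i)) (D z (pos i)).
  apply: (@le_trans _ _ (far_profile m.+1 L x i)); last first.
    by rewrite lerDl far_profile_ge0.
  rewrite /far_profile iL rx /= split; apply: ler_wpM2l; first exact: powR_ge0.
  exact: anti.
apply: (@le_trans _ _ (far_profile m.+1 L z i)); last first.
  by rewrite lerDr far_profile_ge0.
rewrite /far_profile iL rz /= split; apply: ler_wpM2r; first exact: powR_ge0.
by apply: anti => //; rewrite mulr_ge0.
Qed.

(** The left-hand side is the quantity to be bounded in order to apply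
    [cluster_tail] to the profile.  Points within r of z are controlled by the near
    sum, as the profile is at most r^(-m beta); the others by
    [far_profile_mul]. *)
Lemma far_kernel_step C1 a m L :
  (forall z, \sum_(i | D z (pos i) <= r) D z (pos i) `^ (- beta)
     <= C1 * r `^ (d - beta)) ->
  (forall x, far_kernel m.+1 L (pos x) <= a * r `^ (d - m.+1%:R * beta)) ->
  forall x z, \sum_i far_profile m L (pos x) i * D (pos z) (pos i) `^ (- beta)
    <= (C1 + 2 * a) * r `^ (d - m.+1%:R * beta).
Proof.
move=> near far x z.
have r0 : 0 < r by apply: lt_le_trans r_ge1.
rewrite (bigID (fun i => D (pos z) (pos i) <= r)) /= mulrDl; apply: lerD.
  apply: (@le_trans _ _ (r `^ (- (m%:R * beta)) *
      \sum_(i | D (pos z) (pos i) <= r) D (pos z) (pos i) `^ (- beta))).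
    rewrite mulr_sumr; apply: ler_sum => i _; apply: ler_wpM2r.
      exact: powR_ge0.
    rewrite /far_profile; case: ifP => [/andP[_ /ltW rx]|_]; last exact: powR_ge0.
    rewrite !powRN lef_pV2 ?posrE ?powR_gt0//.
    by apply: ge0_ler_powR; rewrite ?nnegrE ?mulr_ge0 ?(ltW (D_gt0 _ _)) ?(ltW r0).
  apply: le_trans (ler_wpM2l _ (near (pos z))) _; first exact: powR_ge0.
  rewrite mulrCA (_ : d - m.+1%:R * beta = - (m%:R * beta) + (d - beta)); last first.
    by rewrite -natr1; ring.
  by rewrite [in leRHS]powRD ?(gt_eqF r0) ?implybT.
apply: (@le_trans _ _ (far_kernel m.+1 L (pos x) + far_kernel m.+1 L (pos z))).
  rewrite !far_kernelE -big_split /= [leRHS](bigID (fun i => D (pos z) (pos i) <= r)) /=.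
  rewrite -[leLHS]add0r; apply: lerD.
    by apply: sumr_ge0 => i _; rewrite addr_ge0 ?far_profile_ge0.
  by apply: ler_sum => i; rewrite -ltNge; exact: far_profile_mul.
apply: le_trans (lerD (far x) (far z)) _.
by apply: ler_of_eq; ring.
Qed.
End FarKernel.

Section IntersectionTail.
Variables (R : realType) (V : choiceType) (D : V -> V -> R) (d c : R).
Hypothesis D_ge1 : forall x y, 1 <= D x y.
Hypothesis D_refl : forall x, D x x = 1.
Hypothesis D_sym : forall x y, D x y = D y x.
Hypothesis D_triangle : forall x y z, D x z <= D x y + D y z.
Hypothesis c_gt0 : 0 < c.
Hypothesis D_growth : forall x r (U : {fset V}), 1 <= r ->
  \sum_(u <- U | D x u <= r) 1 <= c * r `^ d.
Hypothesis V_countable : countable [set: V].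
Variables (disp : measure_display) (Omega : measurableType disp).
Variables (P : probability Omega R) (G : Omega -> graph V).
Hypothesis G_random : random_set G.
Hypothesis G_BK : BK_inequality P G.
Variables (alpha Ctau : R).
Hypothesis alpha_range : d / 2 < alpha < d.
Hypothesis alpha_ge0 : 0 <= alpha.
Hypothesis Ctau_gt0 : 0 < Ctau.
Hypothesis connectivity_le : forall x y, connectivity P G x y <= Ctau * D x y `^ (- alpha).
Variables (disp' : measure_display) (Omega' : measurableType disp').
Variables (Q : probability Omega' R) (C0 : nat -> Omega' -> set V) (o : V).
Hypothesis C0_copies : independent_copies P (fun w => component (G w) o) Q C0.

Let beta := 2 * alpha - d.

Lemma measurable_trace_pred (T : finType) (pos : T -> V) x (E : set {set T}) :
  measurable [set w | E (trace pos (component (G w) x))].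
Proof.
rewrite (_ : [set _ | _] = \bigcup_(S in E)
    (fun w => trace pos (component (G w) x)) @^-1` [set S]).
  apply: countable_bigcup_measurable => // S _.
  exact: measurable_trace_component.
by apply/seteqP; split=> [w Ew|w [S ES /= wS]];
  [exists (trace pos (component (G w) x)) | rewrite wS].
Qed.

(** The chain of far sums: with k - j copies left, the far sum is at most
    a_j r^(d - (k-j) beta) at all points, where a_(j+1) = lambda (C1 + 2 a_j).  Each
    step then costs at most B #|T| exp(- kappa lambda r^beta), and
    lambda = theta / kappa.  For j = 0 this is the convergence of the far sum with
    exponent k beta > d; for j = k the far sum counts points. *)
Lemma intersection_tail (k : nat) (theta : R) : d < k%:R * beta -> 0 < theta ->
  exists A B, [/\ 0 < A, 0 < B &
    forall (T : finType) (pos : T -> V) (r : R), injective pos -> 1 <= r ->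
    pr Q [set w | A * r `^ d < #|common C0 pos k w|%:R]
      <= B * #|T|%:R * expR (- (theta * r `^ beta))].
Proof.
move=> kbeta theta0.
have b0 : 0 < beta by rewrite /beta; move: alpha_range => /andP[h _]; lra.
have bd : beta < d by rewrite /beta; move: alpha_range => /andP[_ h]; lra.
have d0 : 0 <= d by lra.
have [kappa [B [kappa0 B0 tail]]] := cluster_tail D_ge1 D_refl D_sym D_triangle
  c_gt0 D_growth V_countable G_random G_BK alpha_range alpha_ge0 Ctau_gt0 connectivity_le.
have b0d : 0 <= beta < d by rewrite (ltW b0).
have [C1 C10 near] := near_sum_le D_ge1 c_gt0 D_growth b0d.
have [C2 C20 far] := far_sum_le D_ge1 c_gt0 D_growth d0 kbeta.
pose lambda := theta / kappa.
have lambda0 : 0 < lambda by rewrite divr_gt0.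
pose a j := iter j (fun t => lambda * (C1 + 2 * t)) C2.
have a0 j : 0 < a j.
  by elim: j => //= j IH; rewrite mulr_gt0// addr_gt0// mulr_gt0.
exists (c + a k), (k%:R * B + 1); split.
- by rewrite addr_gt0.
- by rewrite ltr_wpDl// mulr_ge0// ltW.
move=> T pos r inj r1.
have r0 : 0 < r by apply: lt_le_trans r1.
have [U sumU] := sum_injective_points R inj.
have near' z : \sum_(i | D z (pos i) <= r) D z (pos i) `^ (- beta) <= C1 * r `^ (d - beta).
  by rewrite (sumU (fun u => D z u <= r) (fun u => D z u `^ (- beta))); exact: near.
pose good j (S : {set T}) := forall x, far_kernel D beta r pos (k - j) S (pos x)
  <= a j * r `^ (d - (k - j)%:R * beta).
pose delta := #|T|%:R * (B * expR (- (theta * r `^ beta))).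
have good0 : good 0%N finset.setT.
  move=> x; rewrite subn0 /far_kernel.
  under eq_bigl do rewrite inE.
  rewrite (sumU (fun u => r < D (pos x) u) (fun u => D (pos x) u `^ (- (k%:R * beta)))).
  exact: far.
have step j S : (j < k)%N -> good j S -> pr P [set w | ~ good j.+1
    (S :&: trace pos (component (G w) o))%SET] <= delta.
  move=> jk gS; set m := (k - j.+1)%N.
  have kj : (k - j)%N = m.+1 by rewrite /m subnSK.
  rewrite /good kj in gS.
  pose ev x := [set w | a j.+1 * r `^ (d - m%:R * beta) <=
    \sum_(i in trace pos (component (G w) o)) far_profile D beta r pos m S (pos x) i].
  apply: (@le_trans _ _ (\sum_(x : T) pr P (ev x))).
    apply: pr_union_le.
    - exact: (measurable_trace_pred pos o (fun S' => ~ good j.+1 (S :&: S')%SET)).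
    - move=> x _ _; exact: (measurable_trace_pred pos o (fun S' =>
        a j.+1 * r `^ (d - m%:R * beta) <=
        \sum_(i in S') far_profile D beta r pos m S (pos x) i)).
    move=> w; apply: contra_notP => none x.
    rewrite leNgt far_kernelI; apply/negP => lt; apply: none.
    by exists x; rewrite mem_index_enum; split => //; exact: ltW.
  rewrite /delta -sum1_card natr_sum mulr_suml; apply: ler_sum => x _; rewrite mul1r.
  pose M := (C1 + 2 * a j) * r `^ (d - m.+1%:R * beta).
  have M0 : 0 < M by rewrite mulr_gt0 ?powR_gt0// addr_gt0// mulr_gt0.
  have phiM z : \sum_i far_profile D beta r pos m S (pos x) i *
      D (pos z) (pos i) `^ (d - 2 * alpha) <= M.
    rewrite (_ : d - 2 * alpha = - beta); last by rewrite /beta; ring.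
    exact: (far_kernel_step D_ge1 (ltW b0) r1 near' gS).
  apply: le_trans (tail T pos _ M _ o (far_profile_ge0 _ _ _ _ _ _ _) M0 phiM) _.
  apply: ler_of_eq; congr (B * expR (- _)).
  rewrite /M /= (_ : d - m%:R * beta = d - m.+1%:R * beta + beta); last first.
    by rewrite -natr1; ring.
  rewrite powRD ?(gt_eqF r0) ?implybT// /lambda; field.
  rewrite !gt_eqF ?powR_gt0//.
  by rewrite addr_gt0// mulr_gt0.
have := pr_common_chain C0_copies good0 step.
move=> chain; apply: (@le_trans _ _ (k%:R * delta)); last first.
  rewrite /delta (_ : k%:R * _ = k%:R * B * #|T|%:R * expR (- (theta * r `^ beta))); last by ring.
  apply: ler_wpM2r; first exact: expR_ge0.
  by apply: ler_wpM2r => //; rewrite lerDl.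
apply: le_trans chain; apply: pr_le.
- exact: (measurable_common C0_copies pos k
    (fun S : {set T} => (c + a k) * r `^ d < #|S|%:R)).
- exact: (measurable_common C0_copies pos k (fun S => ~ good k S)).
move=> w /= big gk; move: big; apply/negP; rewrite -leNgt.
have [->|/set0Pn[x xL]] := eqVneq (common C0 pos k w) finset.set0.
  by rewrite cards0 mulr_ge0 ?powR_ge0// addr_ge0 ?ltW.
rewrite -sum1_card natr_sum (bigID (fun i => D (pos x) (pos i) <= r)) /= mulrDl.
apply: lerD.
  apply: (@le_trans _ _ (\sum_(i | D (pos x) (pos i) <= r) 1)).
    rewrite [leRHS](bigID (mem (common C0 pos k w))) /= -[leLHS]addr0.
    apply: lerD; last by apply: sumr_ge0.
    by under [leLHS]eq_bigl do rewrite andbC.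
  by rewrite (sumU (fun u => D (pos x) u <= r) (fun=> 1)); exact: D_growth.
have := gk x; rewrite subnn mul0r subr0; apply: le_trans.
rewrite /far_kernel; apply: ler_of_eq.
apply: eq_big => [i|i _]; first by rewrite -ltNge.
by rewrite mul0r oppr0 powRr0.
Qed.
End IntersectionTail.

(** * The tail of the intersection of the clusters *)

Section CommonCluster.
Variables (R : realType) (V : metricType R) (o : V) (d : R).
Hypothesis V_countable : countable [set: V].
Hypothesis d_ge1 : 1 <= d.
Hypothesis V_growth : polynomial_growth V d.
Variables (disp : measure_display) (Omega : measurableType disp).
Variables (P : probability Omega R) (G : Omega -> graph V).
Hypothesis G_random : random_set G.
Hypothesis G_BK : BK_inequality P G.
Variable alpha : R.
Hypothesis alpha_range : d / 2 < alpha < d.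
Hypothesis tau_le : exists2 C : R, 0 < C &
  forall x y : V, (tau P G x y <= (C * g_fun alpha x y)%:E)%E.
Variables (disp' : measure_display) (Omega' : measurableType disp').
Variables (Q : probability Omega' R) (C0 : nat -> Omega' -> set V).
Hypothesis C0_copies : independent_copies P (fun w => component (G w) o) Q C0.

(** Truncating the distance at 1 makes g_alpha comparable to a pure power without
    a singularity on the diagonal. *)
Definition dist1 (x y : V) : R := Num.max 1 (mdist x y).

Lemma dist1_ge1 x y : 1 <= dist1 x y.
Proof. by rewrite le_max lexx. Qed.

Lemma dist1_refl x : dist1 x x = 1.
Proof. by rewrite /dist1 mdistxx; apply/max_idPl; exact: ler01. Qed.

Lemma dist1_sym x y : dist1 x y = dist1 y x.
Proof. by rewrite /dist1 metric_sym. Qed.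

Lemma dist1_triangle x y z : dist1 x z <= dist1 x y + dist1 y z.
Proof.
rewrite {1}/dist1 ge_max; apply/andP; split.
  by have := dist1_ge1 x y; have := dist1_ge1 y z; lra.
apply: le_trans (metric_triangle x y z) _.
by apply: lerD; rewrite le_max lexx orbT.
Qed.

Lemma dist1_le x y r : 1 <= r -> (dist1 x y <= r) = (mdist x y <= r).
Proof. by move=> r1; rewrite /dist1 ge_max r1. Qed.

Lemma vball_card : exists2 c, 0 < c & forall x r, 1 <= r ->
  exists B : {fset V}, [set` B] = vball x r /\ #|` B|%:R <= c * r `^ d.
Proof.
have [c1 [c2 [c10 c20 growth]]] := V_growth; exists c2 => // x r r1.
have /andP[_] := growth x r r1; rewrite /counting.
case: asboolP => // fin; rewrite lee_fin => le_c.
by exists (fset_set (vball x r)); rewrite fset_setK.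
Qed.

Lemma dist1_growth : exists2 c, 0 < c &
  forall x r (U : {fset V}), 1 <= r -> \sum_(u <- U | dist1 x u <= r) 1 <= c * r `^ d.
Proof.
have [c c0 ball] := vball_card; exists c => // x r U r1.
have [B [BE Bc]] := ball x r r1; apply: le_trans Bc.
rewrite -big_filter big_const_seq count_predT iter_addr_0 ler_nat.
rewrite cardfE cardE -(size_map val) uniq_leq_size ?filter_uniq ?fset_uniq// => u.
rewrite mem_filter dist1_le// => /andP[ur _].
have uB : u \in B by have : [set` B] u by rewrite BE.
by apply/mapP; exists [` uB]%fset; rewrite ?mem_enum.
Qed.

Lemma g_fun_le x y : g_fun alpha x y <= dist1 x y `^ (- alpha).
Proof.
have a0 : 0 <= alpha by move: alpha_range d_ge1 => /andP[h _] h1; lra.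
have m0 := mdist_ge0 x y.
rewrite /g_fun powRN lef_pV2 ?posrE ?powR_gt0 ?(lt_le_trans _ (dist1_ge1 x y))//; last first.
  by rewrite ltr_pwDl// powR_ge0.
rewrite /dist1; case: (leP (mdist x y) 1) => _.
  by rewrite powR1 lerDl powR_ge0.
by rewrite lerDr.
Qed.

Let I k w : set V := \bigcap_(i < k) C0 i w.

(** More than t points means containing one of the countably many finite sets with
    more than t points. *)
Lemma measurable_counting_gt k (t : R) :
  measurable [set w | (t%:E < counting (I k w))%E].
Proof.
rewrite (_ : [set _ | _] = \bigcup_(A in [set A : set V | finite_set A /\ (t%:E < @counting V R A)%E])
    [set w | A `<=` I k w]).
  apply: countable_bigcup_measurable.
    apply: sub_countable (countable_finite_subset V_countable).
    by apply: subset_card_le => A [].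
  move=> A [/finite_fsetP[F ->] _].
  rewrite (_ : [set w | _] = \bigcap_(i < k) (C0 i @^-1` [set A | forall x, x \in F -> A x])).
    apply: bigcap_measurableType => i _; apply: (measurable_copy C0_copies).
    by apply: set_events_fin_bigcap => x _; exact: set_events_mem.
  apply/seteqP; split=> w /= h; first by move=> i ik x xF; exact: (h x xF).
  by move=> x xF i ik; exact: h.
apply/seteqP; split=> w /=; last first.
  move=> [A [/finite_fsetP[F ->]]] + AI; rewrite {2}/counting.
  rewrite /counting; case: (asboolP (finite_set (I k w))) => [fin|_ _]; last exact: ltry.
  case: asboolP => [_|]; last by have := finite_fset F.
  rewrite !lte_fin => /lt_le_trans; apply; rewrite ler_nat.
  apply: fsubset_leq_card; rewrite set_fsetK.
  by apply/fsubsetP => x xF; rewrite in_fset_set// inE; exact: AI.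
have [fin|inf] := pselect (finite_set (I k w)).
  by move=> h; exists (I k w).
move=> _; have [F FI Fn] := infinite_set_fset (Num.truncn t).+1 inf.
exists [set` F] => //; split; first exact: finite_fset.
rewrite /counting asboolT; last exact: finite_fset.
rewrite set_fsetK lte_fin; apply: lt_le_trans (truncnS_gt t) _.
by rewrite ler_nat.
Qed.

(** Choose r with A r^d = t and cut at the ball L of radius rho = exp(r^beta), which
    has at most c' exp(d r^beta) points; [intersection_tail] is used with
    theta = d + 1 to absorb this factor.  A common point outside of L has probability
    at most sum tau^k <= C rho^(d - k alpha), where k alpha > k beta > d.  For t < A
    the constant B makes the bound trivial. *)
Lemma common_cluster_tail k : d < k%:R * (2 * alpha - d) ->
  exists kappa B, [/\ 0 < kappa, 0 < B & forall t, 1 <= t ->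
    pr Q [set w | (t%:E < counting (I k w))%E]
      <= B * expR (- (kappa * t `^ (2 * alpha / d - 1)))].
Proof.
move=> kb.
have [Ct Ct0 tauC] := tau_le.
have d0 : 0 < d by apply: lt_le_trans d_ge1.
have a0 : 0 <= alpha by move: alpha_range d_ge1 => /andP[h _] h1; lra.
have conn x y : connectivity P G x y <= Ct * dist1 x y `^ (- alpha).
  apply: (@le_trans _ _ (Ct * g_fun alpha x y)); last first.
    by rewrite ler_pM2l// g_fun_le.
  have mlink : measurable [set w | linked (G w) x y].
    exact: (G_random (set_events_linked V_countable x y)).
  by rewrite -lee_fin /connectivity -(prE P mlink); exact: tauC.
have [c c0 growth] := dist1_growth.
have [c' c'0 ball] := vball_card.
have th0 : 0 < d + 1 by lra.
have [A [B [A0 B0 tailL]]] := intersection_tail dist1_ge1 dist1_refl dist1_sym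
  dist1_triangle c0 growth V_countable G_random G_BK alpha_range a0 Ct0 conn
  C0_copies kb th0.
set beta := 2 * alpha - d in kb tailL.
have ka : d < k%:R * alpha.
  apply: lt_le_trans kb _; apply: ler_wpM2l => //.
  by rewrite /beta; move: alpha_range => /andP[_ h]; lra.
have [C3 C30 far] := far_sum_le dist1_ge1 c0 growth (ltW d0) ka.
pose s := 2 * alpha / d - 1.
have s0 : 0 < s by rewrite subr_gt0 ltr_pdivlMr// mul1r; move: alpha_range => /andP[h _]; lra.
pose delta := Num.min 1 (k%:R * alpha - d).
have delta0 : 0 < delta by rewrite lt_min ltr01 subr_gt0.
have As0 : 0 < A `^ s by rewrite powR_gt0.
exists (delta / A `^ s), (B * c' + Ct ^+ k * C3 + expR delta); split.
- by rewrite divr_gt0.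
- by rewrite addr_gt0 ?expR_gt0// addr_gt0 ?mulr_gt0 ?exprn_gt0.
move=> t t1; have t0 : 0 < t by lra.
have mK := measurable_counting_gt k t.
rewrite -/s.
have [tA|At] := ltP t A.
  apply: (@le_trans _ _ 1); first exact: pr_le1.
  apply: (@le_trans _ _ (expR delta * expR (- (delta / A `^ s * t `^ s)))).
    rewrite -expRD -[leLHS]expR0 ler_expR -{1}[delta]mulr1 -mulrA -mulrBr.
    apply: mulr_ge0; first exact: ltW.
    rewrite subr_ge0 mulrC ler_pdivrMr// mul1r.
    by apply: ge0_ler_powR; rewrite ?nnegrE ?(ltW s0) ?(ltW t0) ?(ltW A0) ?(ltW tA).
  apply: ler_wpM2r; first exact: expR_ge0.
  by rewrite lerDr addr_ge0// mulr_ge0 ?exprn_ge0 ?ltW.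
pose r := (t / A) `^ d^-1.
have r1 : 1 <= r.
  rewrite /r -[leLHS](_ : 1 `^ d^-1 = 1); last by rewrite powR1.
  apply: ge0_ler_powR; rewrite ?nnegrE ?invr_ge0 ?divr_ge0 ?(ltW d0) ?(ltW t0) ?(ltW A0)//.
  by rewrite ler_pdivlMr// mul1r.
have tA0 : 0 <= t / A by rewrite divr_ge0 ?ltW.
have rd : A * r `^ d = t.
  by rewrite /r -powRrM mulVf ?gt_eqF// powRr1// mulrC divfK ?gt_eqF.
have rb : r `^ beta = t `^ s / A `^ s.
  rewrite /r -powRrM (_ : d^-1 * beta = s); last by rewrite /s /beta; field; rewrite gt_eqF.
  rewrite powRM ?invr_ge0 ?ltW//; congr (_ * _).
  by rewrite -(powR_inv1 (ltW A0)) -powRrM mulN1r powRN.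
set X := r `^ beta.
have X0 : 0 <= X by exact: powR_ge0.
pose rho := expR X.
have rho1 : 1 <= rho by rewrite -expR0 ler_expR.
have [L [LE Lc]] := ball o rho rho1.
have rhoE y : rho `^ y = expR (y * X) by rewrite /rho expR_powR mulrC.
pose T : finType := L.
pose pos : T -> V := val.
have inj : injective pos := val_inj.
pose out y := if y \in L then set0 else [set w | I k w y].
have outE y : [set w | I k w y] = [set w | forall i, (i < k)%N -> [set A0 : set V | A0 y] (C0 i w)].
  by apply/seteqP; split.
have mout0 y : measurable [set w | I k w y].
  rewrite (_ : [set w | I k w y] = \bigcap_(i < k) (C0 i @^-1` [set A | A y])); last by apply/seteqP; split.
  apply: bigcap_measurableType => i _; apply: (measurable_copy C0_copies).
  exact: set_events_mem.
have mout y : measurable (out y) by rewrite /out; case: ifP.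
have pr_out y : pr Q (out y) <= if y \in L then 0 else Ct ^+ k * dist1 o y `^ (- (k%:R * alpha)).
  rewrite /out; case: ifP => _; first by rewrite /pr measure0.
  rewrite outE (pr_copies C0_copies k (fun=> set_events_mem y)).
  under eq_bigr => i _ do rewrite (pr_copy C0_copies i (set_events_mem y)).
  rewrite prodr_const card_ord.
  rewrite (_ : - (k%:R * alpha) = - alpha * k%:R); last by ring.
  rewrite powRrM powR_mulrn ?powR_ge0// -exprMn.
  apply: lerXn2r; rewrite ?nnegrE ?pr_ge0 ?mulr_ge0 ?powR_ge0 ?(ltW Ct0)//.
  exact: conn.
have cover : [set w | (t%:E < counting (I k w))%E] `<=`
    [set w | t < #|common C0 pos k w|%:R] `|` \bigcup_y out y.
  move=> w /= tK; have [sub|/existsNP[y /not_implyP[Iy yL]]] := pselect (forall y, I k w y -> y \in L).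
    left => /=.
    have finI : finite_set (I k w) by apply: (sub_finite_set (B := [set` L])).
    move: tK; rewrite /counting asboolT// lte_fin => /lt_le_trans; apply.
    rewrite ler_nat cardE -(size_map val); apply: uniq_leq_size (fset_uniq _) _.
    move=> y; rewrite in_fset_set// inE => Iy.
    apply/mapP; exists [` sub y Iy]%fset => //.
    by rewrite mem_enum in_trace; apply/asboolP.
  right; exists y => //; rewrite /out; case: ifP => // yL'; by case: yL.
have mL : measurable [set w | t < #|common C0 pos k w|%:R].
  exact: (measurable_common C0_copies pos k (fun S : {set T} => t < #|S|%:R)).
have mO : measurable (\bigcup_y out y) by exact: countable_bigcup_measurable.
apply: le_trans (pr_le Q mK (measurableU _ _ mL mO) cover) _.
apply: le_trans (prU_le Q mL mO) _.
have XE : delta / A `^ s * t `^ s = delta * X by rewrite /X rb; ring.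
rewrite XE.
have partL : pr Q [set w | t < #|common C0 pos k w|%:R]
    <= B * c' * expR (- (delta * X)).
  have := tailL T pos r inj r1; rewrite rd => /le_trans; apply.
  rewrite -/X (_ : #|T| = #|` L|); last by rewrite cardfE.
  apply: (@le_trans _ _ (B * (c' * rho `^ d) * expR (- ((d + 1) * X)))).
    apply: ler_wpM2r; first exact: expR_ge0.
    by apply: ler_wpM2l => //; exact: ltW.
  rewrite rhoE -!mulrA -expRD; apply: ler_wpM2l; first exact: ltW.
  apply: ler_wpM2l; first exact: ltW.
  rewrite ler_expR (_ : d * X + - ((d + 1) * X) = - (1 * X)); last by ring.
  by rewrite lerN2; apply: ler_wpM2r => //; rewrite ge_min lexx.
have partO : pr Q (\bigcup_y out y) <= Ct ^+ k * C3 * expR (- (delta * X)).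
  apply/ler_addgt0Pr => eta eta0.
  have [F HF] := pr_countable_union_le Q V_countable mO mout (@subset_refl _ _) eta0.
  apply: le_trans HF _; rewrite lerD2r.
  apply: (@le_trans _ _ (\sum_(u <- F | rho < dist1 o u)
      Ct ^+ k * dist1 o u `^ (- (k%:R * alpha)))).
    rewrite [leRHS]big_mkcond; apply: ler_sum => u _.
    apply: le_trans (pr_out u) _.
    case: ifP => uL; first by case: ifP => _; rewrite // mulr_ge0 ?powR_ge0 ?exprn_ge0 ?ltW.
    rewrite ifT// ltNge dist1_le//; apply/negP => uball.
    have : [set` L] u by rewrite LE.
    by rewrite /= uL.
  rewrite -mulr_sumr -mulrA; apply: ler_wpM2l; first by rewrite exprn_ge0// ltW.
  apply: le_trans (far o rho F rho1) _; apply: ler_wpM2l; first exact: ltW.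
  rewrite rhoE ler_expR -[leRHS]mulNr; apply: ler_wpM2r => //.
  by rewrite -opprB lerN2 ge_min lexx orbT.
apply: le_trans (lerD partL partO) _.
rewrite !mulrDl lerDl mulr_ge0 ?expR_ge0//.
Qed.
End CommonCluster.

(** * Consequences of a stretched exponential tail *)

Section StretchedTail.
Variables (R : realType) (disp : measure_display) (Omega : measurableType disp).
Variables (Q : probability Omega R) (K : Omega -> \bar R).
Hypothesis K_nat : forall w, (exists n : nat, K w = n%:R%:E) \/ K w = +oo%E.
Hypothesis K_measurable : forall t : R, measurable [set w | (t%:E < K w)%E].
Variables kappa B s : R.
Hypotheses (kappa_gt0 : 0 < kappa) (B_gt0 : 0 < B) (s_gt0 : 0 < s).
Hypothesis K_tail : forall t, 1 <= t ->
  pr Q [set w | (t%:E < K w)%E] <= B * expR (- (kappa * t `^ s)).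

(** K takes countably many values, so any function of K is measurable. *)
Lemma measurable_comp_K (h : \bar R -> \bar R) : measurable_fun [set: Omega] (fun w => h (K w)).
Proof.
move=> _ Y mY; rewrite setTI.
pose A (n : nat) := [set w | ((n%:R - 2^-1)%:E < K w)%E] `&`
  ~` [set w | ((n%:R : R)%:E < K w)%E].
have AE n : A n = [set w | K w = n%:R%:E].
  apply/seteqP; split=> w; rewrite /A /=; have [[m ->]|->] := K_nat w.
  - rewrite !lte_fin => -[nm /negP]; rewrite -leNgt ler_nat => mn.
    suff -> : m = n by [].
    by apply/eqP; rewrite eqn_leq mn /= -ltnS -(ltr_nat R) -natr1; lra.
  - by rewrite !ltry => -[].
  - by case=> ->; split; rewrite lte_fin ?ltxx//; lra.
  - by [].
have Ainf : [set w | K w = +oo%E] = \bigcap_n [set w | ((n%:R : R)%:E < K w)%E].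
  apply/seteqP; split=> w /=; first by move=> Kw n _ /=; rewrite Kw ltry.
  have [[m Km]|//] := K_nat w; move=> /(_ m Logic.I) /=.
  by rewrite Km ltxx.
rewrite (_ : _ @^-1` Y = \bigcup_(n in [set n : nat | Y (h n%:R%:E)]) A n `|`
    ([set w | K w = +oo%E] `&` [set w | Y (h +oo%E)])).
  apply: measurableU.
    apply: bigcup_measurable => n _; apply: measurableI => //.
    exact: measurableC.
  apply: measurableI; first by rewrite Ainf; apply: bigcapT_measurable.
  have [Yh|Yh] := pselect (Y (h +oo%E)).
    by rewrite (_ : [set _ | _] = setT)//; apply/seteqP; split.
  by rewrite (_ : [set _ | _] = set0)//; apply/seteqP; split.
apply/seteqP; split=> w /=; have [[m Km]|Ki] := K_nat w.
- by rewrite Km => Yw; left; exists m => //; rewrite AE.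
- by rewrite Ki => Yw; right.
- by case=> [[n Yn]|[]]; rewrite ?AE /= => Kw; rewrite Kw.
- by case=> [[n Yn]|[]]; rewrite ?AE /= => Kw; rewrite Kw.
Qed.

(* K^s > n - 1, with level 0 the whole space to account for K = 0. *)
Let level n : set Omega :=
  [set w | n = 0%N \/ ((n.-1%:R `^ s^-1)%:E < K w)%E].

Let measurable_level n : measurable (level n).
Proof.
case: n => [|n]; rewrite /level.
  by rewrite (_ : [set _ | _] = setT)//; apply/seteqP; split=> // w _; left.
rewrite (_ : [set _ | _] = [set w | ((n%:R `^ s^-1)%:E < K w)%E])//.
by apply/seteqP; split=> w /=; [case | right].
Qed.

Let level_pr n : pr Q (level n) <= Num.max B 1 * expR kappa * expR (- (kappa * n%:R)).
Proof.
have M1 : 1 <= Num.max B 1 by rewrite le_max lexx orbT.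
have [n1|] := leqP n 1.
  apply: (@le_trans _ _ 1); first exact: pr_le1.
  rewrite -mulrA -expRD mulr_ege1// -[leLHS]expR0 ler_expR.
  rewrite -{1}[kappa]mulr1 -mulrBr mulr_ge0 ?(ltW kappa_gt0)//.
  by rewrite subr_ge0 lern1.
case: n => [//|[//|n]] _.
rewrite (_ : level n.+2 = [set w | ((n.+1%:R `^ s^-1)%:E < K w)%E]); last first.
  by apply/seteqP; split=> w /=; [case | right].
apply: le_trans (K_tail _) _.
  rewrite -[leLHS](_ : 1 `^ s^-1 = 1); last by rewrite powR1.
  by apply: ge0_ler_powR; rewrite ?nnegrE ?invr_ge0 ?(ltW s_gt0)// ler1n.
rewrite -powRrM mulVf ?gt_eqF// powRr1// -mulrA -expRD.
rewrite (_ : kappa + - (kappa * n.+2%:R) = - (kappa * n.+1%:R)); last first.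
  by rewrite -[n.+2%:R]natr1; ring.
by apply: ler_wpM2r; [exact: expR_ge0 | rewrite le_max lexx].
Qed.

(** If n < K^s <= n + 1 then exp(kappa' K^s) <= exp(kappa' (n+1)), so the integrand is
    at most the sum over n of exp(kappa' n) 1_(level n), whose integral is bounded by
    a geometric series. *)
Lemma stretched_exponential_moment : exists2 kappa', 0 < kappa' &
  (\int[Q]_w expeR (kappa'%:E * poweR (K w) s) < +oo)%E.
Proof.
exists (kappa / 2); first by rewrite divr_gt0.
set k' := kappa / 2; have k'0 : 0 < k' by rewrite divr_gt0.
pose f n w := ((expR (k' * n%:R))%:E * (\1_(level n) w)%:E)%E : \bar R.
have f0 n w : (0 <= f n w)%E by rewrite mule_ge0 ?lee_fin ?expR_ge0.
have mf n : measurable_fun setT (f n).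
  apply: emeasurable_funM; first exact: measurable_cst.
  by apply/measurable_EFinP; exact: measurable_indic.
have fone n w : level n w -> f n w = (expR (k' * n%:R))%:E.
  by move=> lw; rewrite /f indicE mem_set// mule1.
have bound w : (expeR (k'%:E * poweR (K w) s) <= \sum_(0 <= n <oo) f n w)%E.
  have term n : (f n w <= \sum_(0 <= n <oo) f n w)%E.
    apply: le_trans (nneseries_lim_ge n.+1 (fun n _ _ => f0 n w)).
    by rewrite big_nat_recr//= leeDr// sume_ge0.
  have [[m Km]|Ki] := K_nat w; last first.
    rewrite [leRHS](_ : _ = +oo%E) ?leey//; apply/eqyP => A A0.
    have fge1 n : (1 <= f n w)%E.
      rewrite fone ?lee_fin; last by right; rewrite Ki ltry.
      by rewrite -[leLHS]expR0 ler_expR mulr_ge0// ltW.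
    apply: le_trans (nneseries_lim_ge (Num.truncn A).+1 (fun n _ _ => f0 n w)).
    apply: (@le_trans _ _ (\sum_(0 <= n < (Num.truncn A).+1) 1%E)%E); last first.
      by apply: lee_sum => n _; exact: fge1.
    rewrite sumEFin lee_fin sumr_const_nat subn0.
    exact: ltW (truncnS_gt A).
  rewrite Km poweR_EFin; set y := m%:R `^ s.
  have [y0|y0] := leP y 0.
    apply: le_trans (term 0%N); rewrite fone; last by left.
    by rewrite lee_fin mulr0 ler_expR; rewrite pmulr_rle0.
  have ex : exists n, y <= n%:R.
    by exists (Num.truncn y).+1; exact: ltW (truncnS_gt y).
  (* n + 1 is the ceiling of y = K^s, so that n < y <= n + 1. *)
  case: (ex_minnP ex) => -[|n] yn nmin; first by move: yn; rewrite leNgt y0.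
  have ny : n%:R < y by rewrite ltNge; apply/negP => /nmin; rewrite ltnn.
  apply: le_trans (term n.+1); rewrite fone.
    by rewrite lee_fin ler_expR ler_pM2l.
  right; rewrite Km lte_fin /=.
  have -> : m%:R = y `^ s^-1 by rewrite /y -powRrM mulfV ?gt_eqF// powRr1.
  by apply: gt0_ltr_powR; rewrite ?invr_gt0 ?nnegrE ?(ltW y0).
apply: (@le_lt_trans _ _ (\int[Q]_w \sum_(0 <= n <oo) f n w)%E).
  apply: ge0_le_integral => //.
  - by move=> w _; exact: expeR_ge0.
  - exact: (measurable_comp_K (fun x => expeR (k'%:E * poweR x s))).
  - by apply: ge0_emeasurable_sum => [n w _ _|n _]; [exact: f0 | exact: mf].
rewrite integral_nneseries//.
set C := Num.max B 1 * expR kappa.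
have C0 : 0 < C by rewrite mulr_gt0 ?expR_gt0// lt_max ltr01 orbT.
pose q := expR (- k'); have q1 : q < 1 by rewrite expR_lt1 oppr_lt0.
have q0 : 0 < q := expR_gt0 _.
have intf n : (\int[Q]_w f n w <= (C * q ^+ n)%:E)%E.
  rewrite ge0_integralZl_EFin ?expR_ge0//; last first.
    by apply/measurable_EFinP; exact: measurable_indic.
  rewrite integral_indic// setIT [X in (_ * X)%E](_ : _ = (pr Q (level n))%:E); last exact: prE.
  rewrite -EFinM lee_fin.
  apply: le_trans (ler_wpM2l (expR_ge0 _) (level_pr n)) _.
  rewrite -/C mulrCA; apply: ler_wpM2l; first exact: ltW.
  rewrite -expRD /q -expRM_natl ler_expR.
  by apply: ler_of_eq; rewrite /k'; field.
apply: (@le_lt_trans _ _ (C / (1 - q))%:E); last exact: ltry.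
apply: lime_le; first by apply: is_cvg_nneseries => n _ _; exact: integral_ge0.
apply: nearW => N.
apply: (@le_trans _ _ (\sum_(0 <= n < N) (C * q ^+ n)%:E)%E).
  by apply: lee_sum => n _; exact: intf.
rewrite sumEFin lee_fin.
have -> : \sum_(0 <= n < N) C * q ^+ n = C / (1 - q) * (1 - q ^+ N).
  elim: N => [|N IH]; first by rewrite big_geq// expr0 subrr mulr0.
  by rewrite big_nat_recr//= IH exprS; field; rewrite subr_eq0 eq_sym lt_eqF.
rewrite ler_piMr ?divr_ge0 ?subr_ge0 ?(ltW C0) ?(ltW q1)//.
by rewrite gerBl exprn_ge0 ?ltW.
Qed.

(** As K is integer-valued, the probability depends on the integer part of t only
    and is largest at the first integer where it is smaller than 1. *)
Lemma tail_lt1_uniform : exists2 q : R, q < 1 & forall t, 0 <= t ->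
  pr Q [set w | (t%:E < K w)%E] < 1 -> pr Q [set w | (t%:E < K w)%E] <= q.
Proof.
have floorE t : 0 <= t -> [set w | (t%:E < K w)%E] =
    [set w | ((Num.truncn t)%:R%:E < K w)%E].
  move=> t0; apply/seteqP; split=> w /=; have [[m ->]|->] := K_nat w; rewrite ?ltry// !lte_fin.
    by move=> tm; apply: le_lt_trans tm; rewrite truncn_le.
  by rewrite ltr_nat => tm; apply: lt_le_trans (truncnS_gt t) _; rewrite ler_nat.
have [[n0 n0P]|none] := pselect (exists n : nat, pr Q [set w | (n%:R%:E < K w)%E] < 1).
  have ex : exists n : nat, pr Q [set w | (n%:R%:E < K w)%E] < 1 by exists n0.
  case: (ex_minnP ex) => n nP nmin.
  exists (pr Q [set w | (n%:R%:E < K w)%E]) => // t t0; rewrite floorE// => /nmin nt.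
  apply: pr_le => // w /=; apply: le_lt_trans.
  by rewrite lee_fin ler_nat.
exists 0 => // t t0; rewrite floorE// => lt1.
by exfalso; apply: none; exists (Num.truncn t).
Qed.

(** For t > t0 half of the rate absorbs the constant B.  On the bounded range t <= t0
    the probability is at most q < 1 whenever it is not 1, and kappa' is chosen
    small enough for the right-hand side to be at least q there. *)
Lemma log_tail : exists kappa' t0 : R, 0 < kappa' /\
  forall t : R, expR 1 < t ->
    t0 < t \/ (Q [set w | (t%:E < K w)%E] < 1)%E ->
    (Q [set w | (t%:E < K w)%E] <= (expR (- (kappa' * (t / ln t) `^ s)))%:E)%E.
Proof.
have [q q1 qP] := tail_lt1_uniform.
pose q' := Num.max q 2^-1.
have q'0 : 0 < q' by rewrite lt_max invr_gt0 ltr0n orbT.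
have q'1 : q' < 1 by rewrite gt_max q1 invf_lt1 ?ltr0n// ltr1n.
pose t0 := Num.max 1 ((2 * `|ln B| / kappa) `^ s^-1).
have t01 : 1 <= t0 by rewrite le_max lexx.
have t00 : 0 < t0 by apply: lt_le_trans t01.
have t0s : 0 < t0 `^ s by rewrite powR_gt0.
pose k1 := - ln q' / t0 `^ s.
have k10 : 0 < k1 by rewrite divr_gt0// oppr_gt0 ln_lt0// q'0.
pose k' := Num.min (kappa / 2) k1.
have k'0 : 0 < k' by rewrite lt_min divr_gt0.
exists k', t0; split=> // t te side.
have t1 : 1 < t by apply: lt_trans te; rewrite expR_gt1.
have tpos : 0 < t by apply: lt_trans t1.
have lnt1 : 1 <= ln t by rewrite -ler_expR lnK ?posrE// ltW.
have small : (t / ln t) `^ s <= t `^ s.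
  apply: ge0_ler_powR; rewrite ?nnegrE ?divr_ge0 ?(ltW s_gt0) ?(ltW tpos) ?(le_trans ler01 lnt1)//.
  rewrite ler_pdivrMr ?(lt_le_trans ltr01 lnt1)//.
  by rewrite ler_peMr// ltW.
rewrite (prE Q (K_measurable t)) lee_fin.
apply: (@le_trans _ _ (expR (- (k' * t `^ s)))); last first.
  by rewrite ler_expR lerN2; apply: ler_wpM2l => //; exact: ltW.
have [tt0|tt0] := ltP t0 t.
  apply: le_trans (K_tail (ltW t1)) _.
  apply: (@le_trans _ _ (expR (kappa / 2 * t `^ s) * expR (- (kappa * t `^ s)))).
    apply: ler_wpM2r; first exact: expR_ge0.
    rewrite -[leLHS]lnK ?posrE// ler_expR (le_trans (ler_norm _))//.
    have u0 : 0 <= 2 * `|ln B| / kappa by rewrite divr_ge0 ?mulr_ge0 ?(ltW kappa_gt0).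
    have : 2 * `|ln B| / kappa <= t `^ s.
      rewrite -[leLHS](_ : ((2 * `|ln B| / kappa) `^ s^-1) `^ s = _); last first.
        by rewrite -powRrM mulVf ?gt_eqF// powRr1.
      apply: ge0_ler_powR; rewrite ?nnegrE ?powR_ge0 ?(ltW s_gt0) ?(ltW tpos)//.
      by apply: le_trans (ltW tt0); rewrite le_max lexx orbT.
    by rewrite ler_pdivrMr//; lra.
  rewrite -expRD ler_expR (_ : kappa / 2 * t `^ s + - (kappa * t `^ s) = - (kappa / 2 * t `^ s)); last by field.
  by rewrite lerN2; apply: ler_wpM2r; rewrite ?powR_ge0// ge_min lexx.
have Qlt1 : pr Q [set w | (t%:E < K w)%E] < 1.
  by case: side => [|]; [rewrite ltNge tt0 | rewrite (prE Q (K_measurable t)) lte_fin].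
apply: le_trans (qP t (ltW tpos) Qlt1) _.
apply: (@le_trans _ _ q'); first by rewrite le_max lexx.
rewrite -[leLHS]lnK ?posrE// ler_expR -lerN2 opprK.
apply: (@le_trans _ _ (k1 * t0 `^ s)); last by rewrite /k1 divfK// gt_eqF.
apply: ler_pM; rewrite ?powR_ge0 ?(ltW k'0)// ?ge_min ?lexx ?orbT//.
by apply: ge0_ler_powR; rewrite ?nnegrE ?(ltW s_gt0) ?(ltW tpos) ?(ltW t00).
Qed.
End StretchedTail.

Unset Implicit Arguments.
Set Strict Implicit.
Local Open Scope ereal_scope.

Theorem theorem1p6 (R : realType) (V : metricType R) (o : V) (d : R)
  (V_countable : countable [set: V])
  (d_ge1 : (1 <= d)%R)
  (V_growth : polynomial_growth V d)
  (disp : measure_display) (Omega : measurableType disp)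
  (P : probability Omega R) (G : Omega -> graph V)
  (G_random : random_set G)
  (G_BK : BK_inequality P G)
  (alpha : R) (alpha_range : (d / 2 < alpha < d)%R)
  (tau_le : exists2 C : R, (0 < C)%R &
     forall x y : V, tau P G x y <= (C * g_fun alpha x y)%:E)
  (disp' : measure_display) (Omega' : measurableType disp')
  (Q : probability Omega' R) (C0 : nat -> Omega' -> set V)
  (C0_copies : independent_copies P (fun w => component (G w) o) Q C0) :
  (forall k : nat, (2 <= k)%N ->
     (k.+1%:R * d / (2 * k%:R) < alpha < k%:R * d / (2 * k.-1%:R))%R ->
     exists2 kappa : R, (0 < kappa)%R &
       \int[Q]_w expeR (kappa%:E *
         poweR (counting (\bigcap_(i < k) C0 i w)) (2 * alpha / d - 1))
         < +oo)
  /\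
  (forall k : nat, (3 <= k)%N ->
     alpha = (k%:R * d / (2 * k.-1%:R))%R ->
     exists kappa t0 : R, (0 < kappa)%R /\
       forall t : R, (expR 1 < t)%R ->
         (t0 < t)%R \/ Q [set w | t%:E < counting (\bigcap_(i < k) C0 i w)] < 1 ->
         Q [set w | t%:E < counting (\bigcap_(i < k) C0 i w)] <=
         (expR (- (kappa * (t / ln t) `^ (2 * alpha / d - 1))))%:E).
Proof.
have /andP[alpha_gt alpha_lt] := alpha_range.
have d_gt0 : (0 < d)%R by apply: lt_le_trans d_ge1.
have s_gt0 : (0 < 2 * alpha / d - 1)%R.
  by rewrite subr_gt0 ltr_pdivlMr// mul1r; move: alpha_gt; lra.
have K_nat k w : (exists n : nat,
    counting (\bigcap_(i < k) C0 i w) = (n%:R : R)%:E) \/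
    counting (\bigcap_(i < k) C0 i w) = +oo :> \bar R.
  by rewrite /counting; case: asboolP => _; [left; eexists | right].
have K_measurable k := measurable_counting_gt V_countable C0_copies k.
have tail k := @common_cluster_tail R V o d V_countable d_ge1 V_growth disp Omega
  P G G_random G_BK alpha alpha_range tau_le disp' Omega' Q C0 C0_copies k.
split=> [k k_ge2 /andP[k_lo _]|k k_ge3 alphaE].
  have k_gt0 : (0 < k%:R :> R)%R by rewrite ltr0n (leq_trans _ k_ge2).
  have [|kappa [B [kappa_gt0 B_gt0 K_tail]]] := tail k.
    move: k_lo; rewrite ltr_pdivrMr ?mulr_gt0// -natr1; lra.
  exact: (stretched_exponential_moment (K_nat k) (K_measurable k) kappa_gt0 s_gt0 K_tail).
have [|kappa [B [kappa_gt0 B_gt0 K_tail]]] := tail k.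
  case: k k_ge3 alphaE => // k k_ge3 /= alphaE.
  have k_gt0 : (0 < k%:R :> R)%R by rewrite ltr0n (leq_trans _ (k_ge3 : (2 <= k)%N)).
  have : (alpha * (2 * k%:R) = k.+1%:R * d)%R by rewrite alphaE divfK// gt_eqF// mulr_gt0.
  by rewrite -natr1; move: alpha_gt; lra.
exact: (log_tail (K_nat k) (K_measurable k) kappa_gt0 B_gt0 s_gt0 K_tail).
Qed.
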